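(* Let $U$ be a set of patterns of the form $V(k1)V^C$ and let $\mathrm{Av}_n$, $\pi_\downarrow$ and $\Delta_{\mathrm{Av}}$ be the associated avoidance sets, downward projection and coproduct (see context). Let $z\in \mathrm{Av}_n$. Then $$\Delta_{\mathrm{Av}}(z)=\sum_{T\text{ good with respect to } z} I_T\otimes J_T,$$ where, for a good subset $T\subseteq[n]$ with $|T|=p$, $q=n-p$ and $T^C=[n]\setminus T$, $I_T$ is the sum of all elements of the interval $[\mathrm{st}(z_{\min}|_T),\ \pi_\downarrow(\mathrm{st}(z_{\max}|_T))]$ in the poset $\mathrm{Av}_p$, and $J_T$ is the sum of all elements of the interval $[\mathrm{st}(z_{\min}|_{T^C}),\ \pi_\downarrow(\mathrm{st}(z_{\max}|_{T^C}))]$ in the poset $\mathrm{Av}_q$.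
   Context: $[n]=\{1,\dots,n\}$, and $S_n$ is the set of permutations of $[n]$ in one-line notation ($S_0=\{\emptyset\}$ contains only the empty permutation). An inversion of $x=x_1\cdots x_n$ is a pair of values $(x_i,x_j)$ with $i<j$, $x_i>x_j$. Weak order on $S_n$: $x\le x'$ iff the inversion set of $x$ is contained in that of $x'$; this is a lattice. For a set $T=\{t_1<\dots<t_m\}$ of integers and $x\in S_m$, $(x)_T$ is the permutation of $T$ with $t_j$ in position $i$ when $x_i=j$; the standardization $\mathrm{st}$ is the inverse operation, i.e. $\mathrm{st}((x)_T)=x$. For $T\subseteq[n]$ and $x\in S_n$, $x|_T$ is obtained from the one-line notation of $x$ by deleting all entries not in $T$. Patterns: each element of $U$ is a pattern $V(k1)V^C$ given by some $k\ge2$ and $V\subseteq\{2,\dots,k-1\}$, with $V^C$ the complement of $V$ in $\{2,\dots,k-1\}$ ($k$ and $V$ may vary within $U$). With $j=|V|$, an instance of $V(k1)V^C$ in $x\in S_n$ is a subsequence $x_{i_1}\cdots x_{i_k}$ ($i_1<\dots<i_k$) with $i_{j+2}=i_{j+1}+1$ whose standardization has the form $v\,k\,1\,v'$ with $v$ a permutation of $V$ and $v'$ a permutation of $V^C$. $\mathrm{Av}_n$ is the set of $x\in S_n$ containing no instance of any pattern in $U$, with the partial order induced by the weak order. The map $\pi_\downarrow:S_n\to\mathrm{Av}_n$ is defined recursively: $\pi_\downarrow(x)=x$ if $x\in\mathrm{Av}_n$; otherwise choose any instance of a pattern of $U$ in $x$, swap the adjacent entries $x_{i_{j+1}}$ and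 $x_{i_{j+2}}$ (those playing the roles of $k$ and $1$) to get $x'$, and put $\pi_\downarrow(x)=\pi_\downarrow(x')$ (known to be well defined). Permutations $x,x'\in S_n$ are equivalent if $\pi_\downarrow(x)=\pi_\downarrow(x')$. It is known that this is a lattice congruence on the weak order, whose classes are intervals, and $\pi_\downarrow(x)$ is the minimum of the class of $x$. Coproduct: let $\mathbb K$ be a field, and let $\mathbb K[S_\infty]=\bigoplus_{n\ge0}\mathbb K[S_n]$ and $\mathbb K[\mathrm{Av}_\infty]=\bigoplus_{n\ge0}\mathbb K[\mathrm{Av}_n]$ have bases the permutations and the avoiders. For $x\in S_n$, $\Delta(x)=\sum_{i=0}^n \mathrm{st}(x_1\cdots x_i)\otimes\mathrm{st}(x_{i+1}\cdots x_n)$ (empty words give $\emptyset$). For $z\in\mathrm{Av}_n$ let $c(z)=\sum_{y\in S_n,\ \pi_\downarrow(y)=z}y$; for $x\in S_n$ let $\rho(x)=x$ if $x\in\mathrm{Av}_n$ and $\rho(x)=0$ otherwise; extend linearly. Then $\Delta_{\mathrm{Av}}(z)=(\rho\otimes\rho)(\Delta(c(z)))$. Good sets: given $z\in\mathrm{Av}_n$, $T\subseteq[n]$ is good with respect to $z$ if there is $z'=z'_1\cdots z'_n\in S_n$ with $\pi_\downarrow(z')=z$ and $T=\{z'_1,\dots,z'_{|T|}\}$. For such $T$, $z_{\min}$ (resp. $z_{\max}$) is the minimal (resp. maximal) element, in the weak order on $S_n$, among permutations equivalent to $z$ whose first $|T|$ entries are the elements of $T$. *)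

(* Defs.v *)
From mathcomp Require Import all_boot all_fingroup all_algebra.
From mathcomp Require Import boolp classical_sets.
From mathcomp.multinomials Require Import freeg.

Set Implicit Arguments.
Unset Strict Implicit.
Unset Printing Implicit Defensive.

Import GRing.Theory.
Local Open Scope nat_scope.

(* Permutations of [n] are elements of 'S_n, i.e. positions and values are
   numbered from 0: the letter x_i of the one-line notation is x (i - 1) + 1,
   and subsets of [n] are sets of type {set 'I_n}. *)

Section Words.
Variable n : nat.
Implicit Types (x : 'S_n) (T : {set 'I_n}).

Definition word x : seq nat := [seq val (x i) | i <- enum 'I_n].

(* x|_T *)
Definition restr x T : seq nat := [seq val a | a <- codom x & a \in T].

Definition prefix_set x (p : nat) : {set 'I_n} := [set x i | i : 'I_n & i < p].

Definition inversions x : {set 'I_n * 'I_n} :=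
  [set (x ij.1, x ij.2) | ij : 'I_n * 'I_n & (ij.1 < ij.2) && (x ij.2 < x ij.1)].

Definition weak_le x y : bool := inversions x \subset inversions y.

End Words.

(* (x)_T, where the set T is given by the sorted sequence t of its elements *)
Definition relabel m (t : seq nat) (x : 'S_m) : seq nat :=
  [seq nth 0 t (x i) | i <- enum 'I_m].

(* To be used when w consists of m distinct letters; such a w is (x)_T for a
   unique x, and the default value 1 is then not reached. *)
Definition st m (w : seq nat) : 'S_m :=
  xget 1%g (fun x : 'S_m => relabel (sort leq w) x = w).

(* The pattern V(k1)V^C.  With values numbered from 0, the letters "k" and "1"
   are k.-1 and 0, and {2, ..., k-1} is {1, ..., k-2}. *)
Definition middle k : {set 'I_k} := [set a : 'I_k | 0 < a < k.-1].

Record pattern := Pattern {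
  pat_k : nat;
  pat_V : {set 'I_pat_k};
  pat_k_ge2 : 2 <= pat_k;
  pat_V_middle : pat_V \subset middle pat_k
}.

Definition pat_VC (P : pattern) : {set 'I_(pat_k P)} :=
  middle (pat_k P) :\: pat_V P.

Lemma card_middle k : #|middle k| <= k - 2.
Proof.
case: k => [|[|k]].
- by rewrite (leq_trans (max_card _)) ?card_ord.
- by rewrite leqn0 cards_eq0; apply/eqP/setP => -[[|a] lt_a]; rewrite !inE.
have -> : middle k.+2 = ~: [set ord0; ord_max].
  apply/setP => a; rewrite !inE negb_or -!val_eqE /= lt0n.
  by congr (_ && _); rewrite ltn_neqAle -ltnS ltn_ord andbT.
by rewrite cardsCs finset.setCK card_ord cards2.
Qed.

Lemma pat_pos1_subproof (P : pattern) : #|pat_V P|.+1 < pat_k P.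
Proof.
have := leq_trans (subset_leq_card (pat_V_middle P)) (card_middle _).
by rewrite leq_subRL ?pat_k_ge2 // addnC addn2.
Qed.

(* The (0-based) positions of the letters "k" and "1" in V(k1)V^C. *)
Definition pat_posk (P : pattern) : 'I_(pat_k P) :=
  Ordinal (ltnW (pat_pos1_subproof P)).
Definition pat_pos1 (P : pattern) : 'I_(pat_k P) :=
  Ordinal (pat_pos1_subproof P).

(* w = v k 1 v' with v a permutation of V and v' a permutation of V^C *)
Definition has_form (P : pattern) (w : 'S_(pat_k P)) : Prop :=
  [/\ perm_eq (take #|pat_V P| (codom w)) (enum (pat_V P)),
      w (pat_posk P) = (pat_k P).-1 :> nat,
      w (pat_pos1 P) = 0 :> nat
    & perm_eq (drop #|pat_V P|.+2 (codom w)) (enum (pat_VC P))].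

Definition is_instance n (x : 'S_n) (P : pattern)
    (i : 'I_(pat_k P) -> 'I_n) : Prop :=
  [/\ {homo i : a b / (a < b)%N},
      i (pat_pos1 P) = (i (pat_posk P)).+1 :> nat
    & has_form (st (pat_k P) [seq val (x (i a)) | a <- enum 'I_(pat_k P)])].

Section Avoidance.
Variable U : set pattern.

Definition avoids n (x : 'S_n) : bool :=
  `[< forall (P : pattern) (i : 'I_(pat_k P) -> 'I_n),
        U P -> ~ is_instance x i >].

Definition Av (n : nat) : Type := {x : 'S_n | avoids x}.

Definition swap_instance n (x x' : 'S_n) : Prop :=
  exists (P : pattern) (i : 'I_(pat_k P) -> 'I_n),
    [/\ U P, is_instance x i
      & x' = (tperm (i (pat_posk P)) (i (pat_pos1 P)) * x)%g].

(* The recursion defining pi_down, with all choices of instances allowed.  It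
   terminates because every swap removes an inversion. *)
Inductive pi_down_rel n : 'S_n -> 'S_n -> Prop :=
| pi_down_stop x : avoids x -> pi_down_rel x x
| pi_down_swap x x' y :
    swap_instance x x' -> pi_down_rel x' y -> pi_down_rel x y.

Definition pi_down n (x : 'S_n) : 'S_n := xget x (pi_down_rel x).

Definition equivalent n (x y : 'S_n) : bool := pi_down x == pi_down y.

Section Good.
Variables (n : nat) (z : 'S_n).
Implicit Types T : {set 'I_n}.

Definition good T : bool :=
  [exists z' : 'S_n, (pi_down z' == z) && (T == prefix_set z' #|T|)].

Definition split_class T : {set 'S_n} :=
  [set x : 'S_n | equivalent x z && (prefix_set x #|T| == T)].

(* split_class T is nonempty when T is good, so the default z is not used. *)
Definition zmin T : 'S_n :=
  xget z (fun x => x \in split_class T /\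
    forall y, y \in split_class T -> weak_le y x -> y = x).

Definition zmax T : 'S_n :=
  xget z (fun x => x \in split_class T /\
    forall y, y \in split_class T -> weak_le x y -> y = x).

End Good.
End Avoidance.

Local Open Scope ring_scope.

(* The tensor product of the spaces with bases A and B is the space with basis
   A * B.  In tensor_map, f and g are meant to be linear. *)
Section Tensor.
Variable K : fieldType.

Definition tensor (A B : choiceType) (u : {freeg A / K}) (v : {freeg B / K}) :
    {freeg (A * B)%type / K} :=
  fglift (fun a => fglift (fun b => << (a, b) >>) v) u.

Definition tensor_map (A B A' B' : choiceType)
    (f : {freeg A / K} -> {freeg A' / K}) (g : {freeg B / K} -> {freeg B' / K})
    (u : {freeg (A * B)%type / K}) : {freeg (A' * B')%type / K} :=
  fglift (fun ab => tensor (f << ab.1 >>) (g << ab.2 >>)) u.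

End Tensor.

Section Coproduct.
Variables (K : fieldType) (U : set pattern).

(* The bases of K[S_oo] and K[Av_oo]. *)
Definition Soo : choiceType := {n : nat & 'S_n}.
Definition Avoo : choiceType := {n : nat & Av U n}.

Definition bS n (x : 'S_n) : {freeg Soo / K} := << (existT _ n x : Soo) >>.
Definition bAv n (z : Av U n) : {freeg Avoo / K} := << (existT _ n z : Avoo) >>.

Definition Delta : {freeg Soo / K} -> {freeg (Soo * Soo)%type / K} :=
  fglift (fun x : Soo => let: existT n x := x in
    \sum_(i < n.+1) tensor (bS (st i (take i (word x))))
                           (bS (st (n - i) (drop i (word x))))).

Definition class_sum : {freeg Avoo / K} -> {freeg Soo / K} :=
  fglift (fun z : Avoo => let: existT n z := z in
    \sum_(y : 'S_n | pi_down U y == val z) bS y).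

Definition rho : {freeg Soo / K} -> {freeg Avoo / K} :=
  fglift (fun x : Soo => let: existT n x := x in
    if (insub x : option (Av U n)) is Some z then bAv z else 0).

Definition DeltaAv (u : {freeg Avoo / K}) : {freeg (Avoo * Avoo)%type / K} :=
  tensor_map rho rho (Delta (class_sum u)).

(* The sum of the elements of the interval [a, b] of Av_p. *)
Definition interval_sum p (a b : 'S_p) : {freeg Avoo / K} :=
  \sum_(y : Av U p | weak_le a (val y) && weak_le (val y) b) bAv y.

Definition I_sum n (z : 'S_n) (T : {set 'I_n}) : {freeg Avoo / K} :=
  let p := #|T| in
  interval_sum (st p (restr (zmin U z T) T))
               (pi_down U (st p (restr (zmax U z T) T))).

Definition J_sum n (z : 'S_n) (T : {set 'I_n}) : {freeg Avoo / K} :=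
  let q := (n - #|T|)%N in
  interval_sum (st q (restr (zmin U z T) (~: T)))
               (pi_down U (st q (restr (zmax U z T) (~: T)))).

End Coproduct.

(* Main.v *)
Require Import Defs.
From mathcomp Require Import boolp classical_sets.
From mathcomp.multinomials Require Import freeg.
From mathcomp Require Import all_boot all_fingroup all_algebra.
From mathcomp Require Import zify.

Set Implicit Arguments.
Unset Strict Implicit.
Unset Printing Implicit Defensive.

Import GRing.Theory.
Local Open Scope nat_scope.

(** The class of an avoider [z] for the equivalence [pi_down x = pi_down y] is
    convex and closed under meets and joins of the weak order. The
    permutations whose first [#|T|] letters are the elements of [T] form an
    interval of the weak order which, through the standardizations of the two
    factors, is isomorphic to the product of two smaller weak orders. Hence,
    for a good set [T], the part of the class that lies in this interval is
    the interval [[zmin, zmax]], and it is the product of an interval for the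
    first factor and one for the second ([split_class_interval],
    [weak_le_split]). The coproduct of [z] is the sum over the good [T] of all
    [u (x) v], where the pair [(u, v)] runs over this product and both entries
    avoid [U]. Finally an avoider [u] satisfies [u <= y] if and only if [u <=
    pi_down y], which turns the upper bounds into those of the theorem
    ([avoider_le_pi_down]).

    The closure properties of the class rest on the following description of
    pattern instances. A descent [b a] of adjacent letters, with [a < b],
    plays the roles of [k] and [1] in an instance if and only if the set of
    the values between [a] and [b] that lie to the left contains, in the sense
    of [spans_pattern], one of the patterns; this condition only gets weaker
    when the interval of values from [a] to [b] grows. This monotonicity
    resolves the critical pair [c b a -> b c a], [c b a -> c a b]: if one of
    the two swaps is allowed, then so are the swaps parallel to it and the
    swaps of [c a] in the hexagon of the six words on [a], [b] and [c]. The
    resulting [local_confluence] shows by induction on the number of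
    inversions that [pi_down] is well defined and order preserving. Reversing
    words reverses the weak order and exchanges [V(k1)V^C] with [V^C(k1)V], so
    the same facts for the dual patterns yield a greatest element in each
    class ([class_max]). A meet [m] of two elements of the class of [z]
    satisfies [z <= m], and a join is bounded by the greatest element of the
    class, so monotonicity of [pi_down] keeps both in the class.

    Meets in the weak order come from the argument of Bjorner, Edelman and
    Ziegler: in a finite poset where two elements below a common upper cover
    always have a meet, any two elements with a common upper bound have one
    ([local_meet], [meet_below]). *)

(** * Weak order through relative positions of values *)

Section WeakOrder.
Variable n : nat.
Implicit Types (x y u v w : 'S_n) (a b c d : 'I_n).

Definition before x a b : bool := (x^-1)%g a < (x^-1)%g b.

Lemma mem_inversions x a b :
  ((b, a) \in inversions x) = (a < b) && before x b a.
Proof.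
apply/imsetP/andP => [[[i j]]|[lt_ab lt_ba]].
  by rewrite inE /= => /andP[lt_ij lt_x] [-> ->]; rewrite /before !permK.
by exists ((x^-1)%g b, (x^-1)%g a); rewrite ?inE /= !permKV // lt_ab andbT.
Qed.

Lemma weak_leP x y :
  reflect (forall a b, a < b -> before x b a -> before y b a) (weak_le x y).
Proof.
apply: (iffP subsetP) => [le_xy a b lt_ab xba | le_xy [b a]].
  by have := le_xy (b, a); rewrite !mem_inversions lt_ab xba; apply.
by rewrite !mem_inversions => /andP[lt_ab /(le_xy _ _ lt_ab)->]; rewrite lt_ab.
Qed.

Lemma weak_le_refl x : weak_le x x.
Proof. exact: subxx. Qed.

Lemma weak_le_trans y x w : weak_le x y -> weak_le y w -> weak_le x w.
Proof. exact: subset_trans. Qed.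

Lemma before_irr x a : before x a a = false.
Proof. exact: ltnn. Qed.

Lemma before_trans x b a c : before x a b -> before x b c -> before x a c.
Proof. exact: ltn_trans. Qed.

Lemma pos_neq x a b : a != b -> (x^-1)%g a != (x^-1)%g b :> nat.
Proof. by apply: contra_neq => /val_inj/perm_inj. Qed.

Lemma before_total x a b : a != b -> before x a b = ~~ before x b a.
Proof. by move=> /(pos_neq x); rewrite /before; lia. Qed.

Lemma card_pos_lt x k : k <= n -> #|[set c | (x^-1)%g c < k]| = k.
Proof.
move=> le_kn; transitivity #|[set i : 'I_n | i < k]|.
  rewrite -(card_preimset [set i : 'I_n | i < k] (@perm_inj _ x^-1%g));
    apply: eq_card => c.
  by rewrite !inE.
rewrite cardsE -sum1_card -[RHS]card_ord -sum1_card.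
by rewrite (big_ord_widen n (fun=> 1)).
Qed.

(** A permutation is determined by its relation [before]: the position of a
    value counts the values before it. This is what makes the weak order
    antisymmetric. *)
Lemma pos_count x a : (x^-1)%g a = #|[set c | before x c a]| :> nat.
Proof. by rewrite card_pos_lt // ltnW. Qed.

Lemma before_inj x y : (forall a b, before x a b = before y a b) -> x = y.
Proof.
move=> eq_xy; apply: invg_inj; apply/permP => a; apply/val_inj.
by rewrite /= !pos_count; apply: eq_card => c; rewrite !inE eq_xy.
Qed.

Lemma weak_le_anti x y : weak_le x y -> weak_le y x -> x = y.
Proof.
move=> /weak_leP le_xy /weak_leP le_yx; apply: before_inj => a b.
have eq_inv (c d : 'I_n) : c < d -> before x d c = before y d c.
  by move=> lt_cd; apply/idP/idP; [apply: le_xy | apply: le_yx].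
have [<-|ne_ab] := eqVneq a b; first by rewrite !before_irr.
have [lt_ab|lt_ba|/val_inj eq_ab] := ltngtP a b.
- by rewrite !(before_total _ ne_ab) eq_inv.
- exact: eq_inv.
- by rewrite eq_ab eqxx in ne_ab.
Qed.

Definition ninv x := #|inversions x|.

Lemma weak_le_ninv x y : weak_le x y -> ninv x <= ninv y.
Proof. exact: subset_leq_card. Qed.

Lemma weak_le_lt x y : weak_le x y -> x != y -> ninv x < ninv y.
Proof.
move=> le_xy; apply: contra_neqT; rewrite -leqNgt => le_yx.
suff eq_inv : inversions x = inversions y.
  by apply: weak_le_anti => //; rewrite /weak_le eq_inv.
by apply/eqP; rewrite eqEcard; apply/andP.
Qed.

(** A descent is recorded by its two letters, the larger one first, rather than
    by its position: disjoint swaps then leave it unchanged. *)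
Definition descent x b a : bool :=
  (a < b) && ((x^-1)%g a == ((x^-1)%g b).+1 :> nat).

(** The entries [b] and [a] are exchanged as values; when they are adjacent
    this is the exchange of two consecutive positions. *)
Definition flip x b a : 'S_n := (x * tperm b a)%g.

Lemma descent_lt x b a : descent x b a -> a < b.
Proof. by case/andP. Qed.

Lemma descent_before x b a : descent x b a -> before x b a.
Proof. by rewrite /before => /andP[_ /eqP->]. Qed.

Lemma pos_flip x b a c : ((flip x b a)^-1)%g c = (x^-1)%g (tperm b a c).
Proof. by rewrite /flip invMg tpermV permM. Qed.

Lemma before_flip x b a c d :
  before (flip x b a) c d = before x (tperm b a c) (tperm b a d).
Proof. by rewrite /before !pos_flip. Qed.

Lemma descent_beforel x b a c : descent x b a -> c != b -> c != a ->
  before x c a = before x c b.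
Proof.
move=> /andP[_ /eqP dba] /(pos_neq x) + /(pos_neq x).
by rewrite /before dba; lia.
Qed.

Lemma descent_beforer x b a c : descent x b a -> c != b -> c != a ->
  before x b c = before x a c.
Proof.
move=> /andP[_ /eqP dba] /(pos_neq x) + /(pos_neq x).
by rewrite /before dba; lia.
Qed.

Lemma descent_neq x b a : descent x b a -> (a == b) = false.
Proof. by case/andP => + _; apply: contraTF => /eqP->; rewrite ltnn. Qed.

(** No third value lies between the two adjacent letters, so every other pair
    keeps its order. *)
Lemma before_flip_id x b a c d : descent x b a -> (c, d) != (b, a) ->
  (c, d) != (a, b) ->
  before (flip x b a) c d = before x c d.
Proof.
move=> dba; rewrite before_flip !xpair_eqE.
case: tpermP => [->|->|/eqP cb /eqP ca];
  rewrite ?eqxx ?(descent_neq dba) 1?[b == a]eq_sym ?(descent_neq dba) /=;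
  case: tpermP => [->|->|/eqP db /eqP da];
    rewrite ?eqxx ?(descent_neq dba) 1?[b == a]eq_sym ?(descent_neq dba)
      //= ?before_irr // => _ _.
- exact/esym/(descent_beforer dba).
- exact: (descent_beforer dba).
- exact: (descent_beforel dba).
- exact/esym/(descent_beforel dba).
Qed.

Lemma before_flip_ba x b a : descent x b a -> before (flip x b a) b a = false.
Proof.
move=> dba; rewrite before_flip tpermL tpermR before_total ?(descent_neq dba)
  //.
by rewrite (descent_before dba).
Qed.

Lemma before_flip_inv x b a c d : descent x b a -> c < d ->
  before (flip x b a) d c = before x d c && ((d, c) != (b, a)).
Proof.
move=> dba lt_cd; have [[-> ->]|ne] := eqVneq;
  first by rewrite before_flip_ba ?andbF.
rewrite andbT before_flip_id //; apply: contraTneq lt_cd => -[-> ->].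
by rewrite -leqNgt ltnW // (descent_lt dba).
Qed.

Lemma inversions_flip x b a : descent x b a ->
  inversions (flip x b a) = inversions x :\ (b, a).
Proof.
move=> dba; apply/setP=> -[d c]; rewrite in_setD1 !mem_inversions.
by case: ltnP => [lt_cd|]; rewrite ?andbF //= before_flip_inv // andbC.
Qed.

Lemma flip_le x b a : descent x b a -> weak_le (flip x b a) x.
Proof. by move=> dba; rewrite /weak_le inversions_flip // subsetDl. Qed.

Lemma ninv_flip x b a : descent x b a -> ninv x = (ninv (flip x b a)).+1.
Proof.
move=> dba; rewrite /ninv inversions_flip // (cardsD1 (b, a) (inversions x)).
by rewrite mem_inversions (descent_lt dba) (descent_before dba).
Qed.

Lemma le_flip x u b a : descent x b a ->
  weak_le u (flip x b a) = weak_le u x && ~~ before u b a.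
Proof.
move=> dba; rewrite /weak_le inversions_flip // subsetD1 mem_inversions.
by rewrite (descent_lt dba).
Qed.

(** Induction on the distance of the positions of two values. *)
Lemma before_ind x (P : 'I_n -> 'I_n -> Prop) :
  (forall a b, before x a b -> (forall c, before x a c -> before x c b ->
    P a c /\ P c b) -> P a b) ->
  forall a b, before x a b -> P a b.
Proof.
move=> IH a b; have [k] := ubnP ((x^-1)%g b - (x^-1)%g a).
elim: k a b => // k IHk a b le_k lt_ab; apply: IH => // c lt_ac lt_cb.
by split; apply: IHk => //; move: le_k lt_ab lt_ac lt_cb; rewrite /before; lia.
Qed.

(** A pair of values [b] before [a] in [y], with [a < b], that is not adjacent
    has a letter [c] in between; comparing [c] with [a] and [b], each of the
    two shorter pairs is either an inversion of [y], treated by induction, or a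
    non-inversion of [y], hence of [x]. *)
Lemma descents_le x y :
  weak_le x y -> (forall b a, descent y b a -> before x b a) -> weak_le y x.
Proof.
move=> /weak_leP le_xy dy; apply/weak_leP => a b lt_ab yba; move: b a yba lt_ab.
apply: before_ind => b a yba IH lt_ab.
have [dba|] := boolP (descent y b a); first exact: dy.
rewrite /descent lt_ab /= => ne_pos.
have lt_pos : ((y^-1)%g b).+1 < (y^-1)%g a by move: yba ne_pos;
  rewrite /before; lia.
pose c := y (Ordinal (ltn_trans lt_pos (ltn_ord _))).
have ybc : before y b c by rewrite /before /c permK.
have yca : before y c a by rewrite /before /c permK.
have [xbc xca] := IH _ ybc yca.
have asc (d e : 'I_n) : d < e -> before y d e -> before x d e.
  move=> lt_de yde; have ne_de : d != e by apply: contraTneq lt_de => ->;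
    rewrite ltnn.
  rewrite (before_total _ ne_de); apply/negP => /(le_xy _ _ lt_de).
  by apply/negP; rewrite -before_total.
have {}xbc : before x b c.
  have [/xbc//|/asc->//|/val_inj eq_cb] := ltngtP c b.
  by rewrite eq_cb before_irr in ybc.
apply: (before_trans xbc).
have [/xca//|/asc->//|/val_inj eq_cb] := ltngtP a c.
by rewrite eq_cb before_irr in yca.
Qed.

(** The weak order is generated by its covers, the flips of descents. *)
Lemma exists_cover x y : weak_le x y -> x != y ->
  exists b a, descent y b a /\ weak_le x (flip y b a).
Proof.
move=> le_xy ne_xy; apply: contraNP ne_xy => no_cover; apply/eqP.
apply: weak_le_anti => //; apply: descents_le => // b a dba.
by apply: contra_notT no_cover => xba; exists b, a; rewrite le_flip // le_xy.
Qed.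

End WeakOrder.

(** * Meets and joins in the weak order *)

Section Lattice.
Variable n : nat.
Implicit Types (x y u v w m t : 'S_n) (a b c d : 'I_n).

Lemma inversions_inj : injective (@inversions n).
Proof. by move=> x y eq_xy; apply: weak_le_anti; rewrite /weak_le eq_xy. Qed.

Lemma descent_eq x b a d c : descent x b a -> descent x d c ->
  (b == d) = (a == c).
Proof.
move=> /andP[_ /eqP pa] /andP[_ /eqP pc].
apply/eqP/eqP => [eq_bd|eq_ac]; apply/(@perm_inj _ x^-1%g)/val_inj => /=.
  by rewrite pa pc eq_bd.
by apply/eqP; rewrite -eqSS -pa -pc eq_ac.
Qed.

Lemma descent_flip_far x b a d c : descent x b a -> descent x d c ->
  b != d -> a != d -> b != c -> descent (flip x b a) d c.
Proof.
move=> dba ddc ne_bd ne_ad ne_bc.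
have ne_ac : a != c by rewrite -(descent_eq dba ddc).
by move: ddc; rewrite /descent !pos_flip !tpermD.
Qed.

(** This lemma and the next three give the descents met on the two ways down
    the hexagon below [c b a], namely [c b a -> b c a -> b a c] and [c b a -> c
    a b -> a c b]. *)
Lemma descent_flip_nearl x c b a : descent x c b -> descent x b a ->
  descent (flip x c b) c a.
Proof.
move=> dcb dba; rewrite /descent (ltn_trans (descent_lt dba) (descent_lt dcb))
  /=.
have ne_ca : c != a by rewrite neq_ltn (ltn_trans (descent_lt dba)
  (descent_lt dcb)) orbT.
have ne_ba : b != a by rewrite neq_ltn (descent_lt dba) orbT.
by rewrite !pos_flip tpermL tpermD //; case/andP: dba.
Qed.

Lemma descent_flip_nearr x c b a : descent x c b -> descent x b a ->
  descent (flip x b a) c a.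
Proof.
move=> dcb dba; rewrite /descent (ltn_trans (descent_lt dba) (descent_lt dcb))
  /=.
have ne_ca : a != c by rewrite neq_ltn (ltn_trans (descent_lt dba)
  (descent_lt dcb)).
have ne_ba : b != c by rewrite neq_ltn (descent_lt dcb).
by rewrite !pos_flip tpermR tpermD //; case/andP: dcb.
Qed.

Lemma descent_flip_nearl2 x c b a : descent x c b -> descent x b a ->
  descent (flip (flip x c b) c a) b a.
Proof.
move=> dcb dba; rewrite /descent (descent_lt dba) /=.
have ne_ca : c != a by rewrite neq_ltn (ltn_trans (descent_lt dba)
  (descent_lt dcb)) orbT.
have ne_ab : a != b by rewrite neq_ltn (descent_lt dba).
have ne_cb : c != b by rewrite neq_ltn (descent_lt dcb) orbT.
rewrite !pos_flip tpermR tpermL (tpermD ne_cb ne_ab) tpermR.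
by case/andP: dcb.
Qed.

Lemma descent_flip_nearr2 x c b a : descent x c b -> descent x b a ->
  descent (flip (flip x b a) c a) c b.
Proof.
move=> dcb dba; rewrite /descent (descent_lt dcb) /=.
have ne_ca : a != c by rewrite neq_ltn (ltn_trans (descent_lt dba)
  (descent_lt dcb)).
have ne_ab : a != b by rewrite neq_ltn (descent_lt dba).
have ne_cb : c != b by rewrite neq_ltn (descent_lt dcb) orbT.
rewrite !pos_flip tpermL tpermR (tpermD ne_cb ne_ab) tpermL.
by case/andP: dba.
Qed.

Lemma flip_comm x b a d c : descent x b a -> descent x d c ->
  b != d -> a != d -> b != c -> flip (flip x b a) d c = flip (flip x d c) b a.
Proof.
move=> dba ddc ne_bd ne_ad ne_bc; apply: inversions_inj.
rewrite !inversions_flip ?descent_flip_far // 1?eq_sym //.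
by rewrite !finset.setDDl finset.setUC.
Qed.

(** Both ways down the hexagon from [c b a] end in [a b c]. *)
Lemma flip_braid x c b a : descent x c b -> descent x b a ->
  flip (flip (flip x c b) c a) b a = flip (flip (flip x b a) c a) c b.
Proof.
move=> dcb dba; apply: inversions_inj.
rewrite !inversions_flip ?descent_flip_nearl2 ?descent_flip_nearr2
  ?descent_flip_nearl ?descent_flip_nearr //.
by apply/setP => e; rewrite !inE andbC -!andbA; do !bool_congr.
Qed.

(** Two disjoint descents are undone together. For [c b a], an element below
    both flips has neither [c] before [b] nor [b] before [a], hence, by
    transitivity, not [c] before [a]: it lies below the bottom [a b c] of the
    hexagon. *)
Lemma local_meet x b a d c : descent x b a -> descent x d c ->
  exists m, [/\ weak_le m (flip x b a), weak_le m (flip x d c) &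
    forall t, weak_le t (flip x b a) -> weak_le t (flip x d c) -> weak_le t m].
Proof.
have near c' b' a' : descent x c' b' -> descent x b' a' ->
    exists m, [/\ weak_le m (flip x c' b'), weak_le m (flip x b' a') &
    forall t, weak_le t (flip x c' b') -> weak_le t (flip x b' a') ->
      weak_le t m].
  move=> dcb dba; exists (flip (flip (flip x c' b') c' a') b' a'); split.
  - apply: weak_le_trans (flip_le (descent_flip_nearl dcb dba)).
    exact: flip_le (descent_flip_nearl2 dcb dba).
  - rewrite flip_braid //; apply: weak_le_trans (flip_le (descent_flip_nearr
    dcb dba)).
    exact: flip_le (descent_flip_nearr2 dcb dba).
  - move=> t t1 t2; rewrite !le_flip ?descent_flip_nearl2 ?descent_flip_nearl
    //.
    move: t1 t2; rewrite !le_flip // => /andP[-> tcb] /andP[_ tba].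
    rewrite tba andbT /=; have := descent_lt dba; have := descent_lt dcb.
    move=> lt_bc lt_ab; have lt_ac := ltn_trans lt_ab lt_bc.
    have ne (i j : 'I_n) : i < j -> i != j by move=> lt_ij;
      rewrite neq_ltn lt_ij.
    move: tcb tba; rewrite -(before_total _ (ne _ _ lt_bc)).
    rewrite -(before_total _ (ne _ _ lt_ab)) -(before_total _ (ne _ _ lt_ac))
      => tbc tab.
    by rewrite tbc; exact: before_trans tab tbc.
move=> dba ddc; have [eq_ad|ne_ad] := eqVneq a d.
  by subst d; exact: near dba ddc.
have [eq_bc|ne_bc] := eqVneq b c.
  subst c; have [m [m1 m2 m3]] := near _ _ _ ddc dba.
  by exists m; split=> // t t1 t2; exact: m3.
have [eq_bd|ne_bd] := eqVneq b d.
  move: (descent_eq dba ddc); rewrite eq_bd eqxx => /esym/eqP <-.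
  by exists (flip x d a); split=> //; exact: weak_le_refl.
have dsw := descent_flip_far dba ddc ne_bd ne_ad ne_bc.
exists (flip (flip x b a) d c); split; first exact: flip_le.
  rewrite flip_comm //; apply/flip_le/descent_flip_far => //; by rewrite eq_sym.
move=> t t1; rewrite le_flip // => /andP[_ tdc].
by rewrite le_flip // t1.
Qed.

(** Induction on the upper bound [x]: replace [u] and [v] by covers of them
    below [x], take the local meet [m] of these covers, then the meet [w] of
    [u] and [m], and finally the meet of [w] and [v]; the last two have a
    smaller common upper bound. *)
Lemma meet_below x u v : weak_le u x -> weak_le v x ->
  exists m, [/\ weak_le m u, weak_le m v &
    forall t, weak_le t u -> weak_le t v -> weak_le t m].
Proof.
have [k] := ubnP (ninv x); elim: k x u v => // k IH x u v lt_k le_ux le_vx.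
have [-> |/(exists_cover le_ux)[b [a [dba le_u]]]] := eqVneq u x.
  by exists v; split=> //; exact: weak_le_refl.
have [-> |/(exists_cover le_vx)[d [c [ddc le_v]]]] := eqVneq v x.
  by exists u; split=> //; exact: weak_le_refl.
rewrite (ninv_flip dba) ltnS in lt_k.
have lt_k' : ninv (flip x d c) < k.
  by move: lt_k; rewrite -(ninv_flip dba) (ninv_flip ddc).
have [m [m1 m2 m3]] := local_meet dba ddc.
have [w [w1 w2 w3]] := IH _ _ _ lt_k le_u m1.
have [s [s1 s2 s3]] := IH _ _ _ lt_k' (weak_le_trans w2 m2) le_v.
exists s; split=> // [|t t1 t2]; first exact: weak_le_trans w1.
apply: s3 => //; apply: w3 => //; apply: m3.
  exact: weak_le_trans le_u.
exact: weak_le_trans le_v.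
Qed.

(** The word read from right to left. This is an anti-automorphism of the weak
    order. *)
Definition rev_perm x : 'S_n := (perm (@rev_ord_inj n) * x)%g.

Lemma pos_rev x a : ((rev_perm x)^-1)%g a = rev_ord ((x^-1)%g a).
Proof.
apply: (@perm_inj _ (rev_perm x)).
by rewrite permKV /rev_perm permM permE rev_ordK permKV.
Qed.

Lemma before_rev x a b : before (rev_perm x) a b = before x b a.
Proof.
rewrite /before !pos_rev /=.
by move: (ltn_ord ((x^-1)%g a)) (ltn_ord ((x^-1)%g b)); lia.
Qed.

Lemma rev_permK : involutive rev_perm.
Proof. by move=> x; apply: before_inj => a b; rewrite !before_rev. Qed.

Lemma weak_le_rev x y : weak_le (rev_perm x) (rev_perm y) = weak_le y x.
Proof.
apply/weak_leP/weak_leP => le_xy a b lt_ab; last first.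
  rewrite !before_rev => xab.
  have ne : a != b by rewrite neq_ltn lt_ab.
  move: xab; rewrite !(before_total _ ne); exact/contra/le_xy.
have ne : b != a by rewrite neq_ltn lt_ab orbT.
rewrite !(before_total _ ne) -!(before_rev _ b a).
exact/contra/le_xy.
Qed.

Lemma weak_le_1 x : weak_le 1%g x.
Proof. by apply/weak_leP => a b lt_ab;
  rewrite /before invg1 !perm1 ltnNge ltnW. Qed.

Lemma weak_le_rev1 x : weak_le x (rev_perm 1%g).
Proof. by rewrite -weak_le_rev rev_permK weak_le_1. Qed.

Lemma weak_le_meet u v : exists m, [/\ weak_le m u, weak_le m v &
  forall t, weak_le t u -> weak_le t v -> weak_le t m].
Proof. by apply: meet_below; exact: weak_le_rev1. Qed.

Lemma weak_le_join u v : exists j, [/\ weak_le u j, weak_le v j &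
  forall t, weak_le u t -> weak_le v t -> weak_le j t].
Proof.
have [m [m1 m2 m3]] := weak_le_meet (rev_perm u) (rev_perm v).
exists (rev_perm m); split; rewrite -1?weak_le_rev ?rev_permK // => t t1 t2.
by rewrite -weak_le_rev rev_permK; apply: m3; rewrite weak_le_rev.
Qed.

End Lattice.

(** * Standardization *)

Section Standardization.
Variable m : nat.
Implicit Types (u v : 'S_m) (i j : 'I_m) (s w t : seq nat).

Lemma size_relabel t u : size (relabel t u) = m.
Proof. by rewrite size_map size_enum_ord. Qed.

Lemma nth_relabel t u i : nth 0 (relabel t u) i = nth 0 t (u i).
Proof. by rewrite (nth_map i) ?nth_ord_enum // size_enum_ord. Qed.

(** The letters of [w] have pairwise distinct ranks, which form the permutation
    sought; so the default value in the definition of [st] is not reached. *)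
Lemma relabel_st w : uniq w -> size w = m -> relabel (sort leq w) (st m w) = w.
Proof.
move=> Uw szw; rewrite /st.
suff ex_u : exists u : 'S_m, relabel (sort leq w) u = w.
  exact: (xgetPex 1%g ex_u).
have lt_m i : index (nth 0 w i) (sort leq w) < m.
  by rewrite -[X in _ < X]szw -(size_sort leq)
    index_mem mem_sort mem_nth // szw.
have inj_f : injective (fun i => Ordinal (lt_m i)).
  move=> i j [] /(congr1 (nth 0 (sort leq w))).
  rewrite !nth_index ?mem_sort ?mem_nth ?szw //.
  by move=> /eqP; rewrite nth_uniq ?szw // => /eqP/val_inj.
exists (perm inj_f); apply: (@eq_from_nth _ 0); first by rewrite size_relabel.
move=> k; rewrite size_relabel => lt_k.
rewrite (nth_relabel _ _ (Ordinal lt_k)) permE /=.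
by rewrite nth_index // mem_sort mem_nth // szw.
Qed.

Lemma nth_st w i : uniq w -> size w = m ->
  nth 0 (sort leq w) (st m w i) = nth 0 w i.
Proof. by move=> Uw szw; rewrite -nth_relabel relabel_st. Qed.

Lemma sorted_nth_lt s i j : sorted ltn s -> i < size s -> j < size s ->
  (nth 0 s i < nth 0 s j) = (i < j).
Proof.
move=> ss szi szj; have lt_nth := sorted_ltn_nth ltn_trans 0 ss.
have [/lt_nth-> //|/lt_nth lt_ji|/val_inj->] := ltngtP i j; last exact: ltnn.
by apply/negbTE; rewrite -leqNgt ltnW // lt_ji.
Qed.

Lemma sorted_sort_uniq w : uniq w -> sorted ltn (sort leq w).
Proof.
by move=> Uw; rewrite ltn_sorted_uniq_leq sort_uniq Uw sort_sorted //;
  exact: leq_total.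
Qed.

Lemma st_lt w i j : uniq w -> size w = m ->
  (st m w i < st m w j) = (nth 0 w i < nth 0 w j).
Proof.
move=> Uw szw; rewrite -(nth_st i Uw szw) -(nth_st j Uw szw)
  sorted_nth_lt ?size_sort ?szw //.
exact: sorted_sort_uniq.
Qed.

(** Two permutations whose words are ordered alike are equal; standardizations
    are identified by this criterion. *)
Lemma perm_order_inj u v : (forall i j, (u i < u j) = (v i < v j)) -> u = v.
Proof.
by move=> eq_uv; apply/invg_inj/before_inj => i j; rewrite /before !invgK eq_uv.
Qed.

Lemma mem_take_codom u i k : (i \in take k (codom u)) = ((u^-1)%g i < k).
Proof.
rewrite -{1}[i](permKV u) codomE -map_take mem_map; last exact: perm_inj.
rewrite -(mem_map val_inj) map_take val_enum_ord take_iota mem_iota /= add0n.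
by rewrite leq_min ltn_ord andbT.
Qed.

Lemma uniq_codom u : uniq (codom u).
Proof. by rewrite codomE map_inj_uniq ?enum_uniq //; exact: perm_inj. Qed.

Lemma mem_drop_codom u i k : (i \in drop k (codom u)) = (k <= (u^-1)%g i).
Proof.
have : i \in codom u by apply/codomP; exists ((u^-1)%g i); rewrite permKV.
have := uniq_codom u; rewrite -{1 2}(cat_take_drop k (codom u))
  cat_uniq mem_cat.
case/and3P=> _ /hasPn/(_ i) + _; rewrite mem_take_codom.
by case: (i \in drop _ _) => [/(_ isT)|_]; case: ltnP.
Qed.

End Standardization.

(** * Pattern instances as contracted descents *)

Section Instances.
Variables (U : set pattern) (n : nat).
Implicit Types (x y : 'S_n) (a b c d : 'I_n) (A : {set 'I_n}).

(** The inner values of [f] are those in the roles of [2, ..., k-1]; the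
    extreme ones may lie anywhere in the interval from [a] to [b], instead of
    being [a] and [b], which makes the condition monotone in the interval. *)
Definition spans_pattern a b A : Prop :=
  exists P, U P /\ exists f : 'I_(pat_k P) -> 'I_n,
    [/\ {homo f : i j / i < j}, forall i, a <= f i <= b &
        {in middle (pat_k P), forall i, (i \in pat_V P) = (f i \in A)}].

Definition contracted x b a : Prop :=
  descent x b a /\ spans_pattern a b [set e | before x e b].

Lemma tperm_flip x (p q : 'I_n) : (tperm p q * x)%g = flip x (x p) (x q).
Proof. by rewrite /flip -tpermJ conjgC. Qed.

Lemma homo_mono k (i : 'I_k -> 'I_n) :
  {homo i : r s / r < s} -> forall r s, (i r < i s) = (r < s).
Proof.
move=> homo_i r s; have [/homo_i //|/homo_i lt_sr|/val_inj ->] := ltngtP r s.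
  by apply/negbTE; rewrite -leqNgt ltnW.
exact: ltnn.
Qed.

Lemma homo_inj k (i : 'I_k -> 'I_n) : {homo i : r s / r < s} -> injective i.
Proof.
move=> homo_i r s eq_i; apply/val_inj/eqP.
have := homo_mono homo_i r s; have := homo_mono homo_i s r.
by rewrite eq_i ltnn /=; case: ltngtP.
Qed.

Lemma nth_enum_map k (f : 'I_k -> nat) (r : 'I_k) :
  nth 0 [seq f i | i <- enum 'I_k] r = f r.
Proof. by rewrite (nth_map r) ?size_enum_ord // nth_ord_enum. Qed.

Lemma st_map_lt k (f : 'I_k -> 'I_n) : injective f -> forall r s,
  (st k [seq val (f i) | i <- enum 'I_k] r < st k [seq val (f i)
    | i <- enum 'I_k] s)
  = (f r < f s).
Proof.
move=> inj_f r s; rewrite st_lt; first by rewrite !nth_enum_map.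
  by rewrite map_inj_uniq ?enum_uniq // => i j /val_inj/inj_f.
by rewrite size_map size_enum_ord.
Qed.

(** The values of an instance, in increasing order, are found by composing with
    the inverse of its standardization; those in the roles of [V] are the ones
    whose position is smaller than that of the letter [k]. *)
Lemma instance_contracted x (P : pattern) (i : 'I_(pat_k P) -> 'I_n) :
  U P -> is_instance x i -> contracted x (x (i (pat_posk P)))
    (x (i (pat_pos1 P))).
Proof.
move=> UP [homo_i eq_i]; set w := st _ _ => -[wV wk w1 _].
have w_lt r s : (w r < w s) = (x (i r) < x (i s)).
  by apply: (@st_map_lt _ (x \o i)); apply: inj_comp;
    [exact: perm_inj|exact: homo_inj].
have k_ge2 := pat_k_ge2 P.
split; first by rewrite /descent -w_lt wk w1 !permK eq_i eqxx andbT; lia.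
exists P; split=> //; exists (fun r => x (i ((w^-1)%g r))).
split=> [r s|r|r mid_r]; first by rewrite -w_lt !permKV.
  have := w_lt ((w^-1)%g r) (pat_pos1 P);
    have := w_lt (pat_posk P) ((w^-1)%g r).
  by rewrite !permKV wk w1; have := ltn_ord r; lia.
rewrite inE /before !permK homo_mono // -mem_enum -(perm_mem wV).
exact: mem_take_codom.
Qed.

(** Conversely, restore [a] and [b] as the extreme values of [f], and read the
    chosen values by increasing positions: the permutation [sg] gives the rank
    of the position of each of them. The rank of [b] is the number of values
    before it, which are those in the roles of [V], and the rank of [a] is one
    more. *)
Lemma contracted_instance x b a : contracted x b a ->
  exists (P : pattern) (i : 'I_(pat_k P) -> 'I_n),
    [/\ U P, is_instance x i, x (i (pat_posk P)) = b & x (i (pat_pos1 P)) = a].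
Proof.
move=> [dba [P [UP [f [homo_f f_ab fV]]]]]; exists P.
have k_ge2 := pat_k_ge2 P; have lt_ab := descent_lt dba.
have lt_0 : 0 < pat_k P by lia.
have lt_max : (pat_k P).-1 < pat_k P by lia.
pose o := Ordinal lt_0; pose k := Ordinal lt_max.
(* The extreme values of f are replaced by a and b themselves. *)
pose d r := if r == o then a else if r == k then b else f r.
have d_o : d o = a by rewrite /d eqxx.
have d_k : d k = b by rewrite /d eqxx -val_eqE /= ifN //; lia.
have d_f r : r != o -> r != k -> d r = f r by rewrite /d => /negbTE-> /negbTE->.
have homo_d : {homo d : r s / r < s}.
  move=> r s lt_rs; have ne_so : s != o by rewrite -val_eqE /=; lia.
  have ne_rk : r != k by rewrite -val_eqE /=; have := ltn_ord s; lia.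
  have [eq_r|ne_ro] := eqVneq r o; have [eq_s|ne_sk] := eqVneq s k.
  - by rewrite eq_r eq_s d_o d_k.
  - rewrite eq_r d_o d_f //; apply: leq_ltn_trans (homo_f o s _).
      by case/andP: (f_ab o).
    by rewrite -eq_r.
  - rewrite eq_s d_k d_f //; apply: leq_trans (homo_f r k _) _.
      by rewrite -eq_s.
    by case/andP: (f_ab k).
  - by rewrite !d_f // homo_f.
(* sg r is the rank of the position of d r among the chosen values, so the
   inverse of sg is the standardization of the instance. *)
pose sg := st (pat_k P) [seq val ((x^-1)%g (d r)) | r <- enum 'I_(pat_k P)].
have sg_lt r s : (sg r < sg s) = before x (d r) (d s).
  apply: (@st_map_lt _ (x^-1%g \o d)).
  by apply: inj_comp; [exact: perm_inj|exact: homo_inj].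
have sg_count r : sg r = #|[set s | sg s < sg r]| :> nat.
  by have := pos_count (sg^-1)%g r; rewrite /before invgK.
have V_mid r : r \in pat_V P -> (r != o) && (r != k).
  move/(subsetP (pat_V_middle P)); rewrite inE -!val_eqE /=; lia.
have o_V : o \notin pat_V P by apply/negP => /V_mid; rewrite eqxx.
have k_V : k \notin pat_V P by apply/negP => /V_mid; rewrite eqxx andbF.
have sg_V r : (sg r < sg k) = (r \in pat_V P).
  rewrite sg_lt d_k; have [->|ne_ro] := eqVneq r o.
    rewrite d_o (negbTE o_V).
    by apply/negbTE; rewrite /before; move: dba; rewrite /descent; lia.
  have [->|ne_rk] := eqVneq r k.
    by rewrite d_k before_irr (negbTE k_V).
  rewrite d_f // fV ?inE //; move: ne_ro ne_rk; rewrite -!val_eqE /=.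
  by have := ltn_ord r; lia.
have sg_k : sg k = #|pat_V P| :> nat.
  by rewrite sg_count; apply: eq_card => r; rewrite inE sg_V.
have sg_o : sg o = #|pat_V P|.+1 :> nat.
  rewrite sg_count -[RHS]add1n.
  rewrite -[1]/(true : nat) -k_V -cardsU1; apply: eq_card => r;
    rewrite !inE -sg_V.
  have [->|ne_rk] := eqVneq r k;
    first by rewrite sg_lt d_k d_o (descent_before dba).
  rewrite /= !sg_lt d_k d_o; have [->|ne_ro] := eqVneq r o.
    by rewrite d_o before_irr; apply/esym/negbTE; rewrite /before; move: dba;
      rewrite /descent; lia.
  rewrite (descent_beforel dba) // -?d_o -?d_k; [move: ne_rk|move: ne_ro].
    by apply: contra_neq => /homo_inj; apply.
  by apply: contra_neq => /homo_inj; apply.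
have posk : pat_posk P = sg k by apply: val_inj; rewrite /= sg_k.
have pos1 : pat_pos1 P = sg o by apply: val_inj; rewrite /= sg_o.
have xi r : x ((x^-1)%g (d ((sg^-1)%g r))) = d ((sg^-1)%g r) by rewrite permKV.
exists (fun r => (x^-1)%g (d ((sg^-1)%g r))).
split=> //; [|by rewrite xi posk permK|by rewrite xi pos1 permK].
split=> [r s lt_rs|/=|].
- by rewrite -[_ < _]/(before x _ _) -sg_lt !permKV.
- by rewrite posk pos1 !permK d_o d_k; case/andP: dba => _ /eqP.
set w := st _ _; have {w}-> : w = (sg^-1)%g.
  apply: perm_order_inj => r s;
    rewrite (@st_map_lt _ (fun r => x ((x^-1)%g (d ((sg^-1)%g r))))).
    by rewrite !xi homo_mono.
  by move=> r' s'; rewrite !xi => /(homo_inj homo_d)/perm_inj.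
split; [|by rewrite posk permK|by rewrite pos1 permK|].
  apply: uniq_perm; rewrite ?enum_uniq ?take_uniq ?uniq_codom // => r.
  by rewrite mem_take_codom invgK mem_enum -sg_k sg_V.
apply: uniq_perm; rewrite ?enum_uniq ?drop_uniq ?uniq_codom // => r.
rewrite mem_drop_codom invgK mem_enum inE -sg_V sg_k.
have neq_o : (r != o) = (sg r != #|pat_V P|.+1 :> nat).
  by rewrite -sg_o (inj_eq val_inj) (inj_eq perm_inj).
have neq_k : (r != k) = (sg r != #|pat_V P| :> nat).
  by rewrite -sg_k (inj_eq val_inj) (inj_eq perm_inj).
have -> : (r \in middle (pat_k P)) = (r != o) && (r != k).
  by rewrite inE -!val_eqE /=; have := ltn_ord r; lia.
by rewrite neq_o neq_k; lia.
Qed.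

Lemma swap_instanceP x y : swap_instance U x y <->
  exists b a, contracted x b a /\ y = flip x b a.
Proof.
split=> [[P [i [UP inst_i ->]]]|[b [a [cba ->]]]].
  exists (x (i (pat_posk P))), (x (i (pat_pos1 P))).
  by rewrite tperm_flip; split=> //; exact: instance_contracted.
have [P [i [UP inst_i eb ea]]] := contracted_instance cba.
by exists P, i; split=> //; rewrite tperm_flip eb ea.
Qed.

Lemma avoidsP x : reflect (forall b a, ~ contracted x b a) (avoids U x).
Proof.
apply: (iffP (asboolP _)) => [no b a /contracted_instance[P [i [UP]]]|no P i
  UP].
  by move=> /(no P i UP).
by move=> /(instance_contracted UP); exact: no.
Qed.

End Instances.

(** * Confluence and monotonicity of the downward projection *)

Section Projection.
Variables (U : set pattern) (n : nat).
Implicit Types (x y z : 'S_n) (a b c d e : 'I_n) (A : {set 'I_n}).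

(** The values with roles strictly between [1] and [k] lie strictly between [a]
    and [b], so only the trace of [A] there matters. This is the forcing
    relation between descents that makes the equivalence a congruence. *)
Lemma spans_pattern_mono a b A a' b' A' : spans_pattern U a b A -> a' <= a ->
  b <= b' ->
  (forall e, a < e < b -> (e \in A) = (e \in A')) -> spans_pattern U a' b' A'.
Proof.
move=> [P [UP [f [homo_f f_ab fV]]]] le_a le_b eqA; exists P; split=> //.
exists f; split=> // [i|i mid_i].
  by have /andP[] := f_ab i => le_af le_fb;
    rewrite (leq_trans le_a) // (leq_trans le_fb).
rewrite fV //; apply: eqA; move: mid_i; rewrite inE => /andP[gt_0 lt_k].
have lt_0k : 0 < pat_k P by have := ltn_ord i; lia.
have lt_max : (pat_k P).-1 < pat_k P by lia.
have /andP[le_f0 _] := f_ab (Ordinal lt_0k).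
have /andP[_ le_fk] := f_ab (Ordinal lt_max).
by rewrite (leq_ltn_trans le_f0) ?homo_f //= (leq_trans _ le_fk) // homo_f.
Qed.

Lemma before_flip_out x b a e d : descent x b a -> e != b -> e != a ->
  before (flip x b a) e d = before x e d.
Proof.
by move=> dba /negbTE ne_b /negbTE ne_a;
  rewrite before_flip_id // xpair_eqE ?ne_b ?ne_a.
Qed.

Lemma contracted_flip_far x b a d c : descent x b a -> contracted U x d c ->
  b != d -> a != d -> b != c -> contracted U (flip x b a) d c.
Proof.
move=> dba [ddc cdc] ne_bd ne_ad ne_bc; split; first exact: descent_flip_far.
apply: spans_pattern_mono cdc _ _ _ => // e _;
  rewrite !inE before_flip_id // xpair_eqE.
  by rewrite [d == a]eq_sym (negbTE ne_ad) andbF.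
by rewrite [d == b]eq_sym (negbTE ne_bd) andbF.
Qed.

(** Reduction is expressed by its effect on the possible results of the
    recursion: a diagram of reductions then closes as soon as one result is
    known. *)
Definition reduces x y : Prop := forall z, pi_down_rel U y z ->
  pi_down_rel U x z.

Lemma reduces_refl x : reduces x x. Proof. by []. Qed.

Lemma reduces_flip x y b a : contracted U x b a -> reduces (flip x b a) y ->
  reduces x y.
Proof.
move=> cba reduces_y z /reduces_y; apply: pi_down_swap.
by apply/swap_instanceP; exists b, a.
Qed.

(** The flips of two distinct descents, one of them contracted, can be
    completed by reductions to a pair that again differs by the flip of [(b,
    a)]. Disjoint descents commute. In a hexagon, the contracted descent forces
    the swap of its extreme letters on either side, and the parallel edge; so
    one of the paths reaches the bottom, and the other one stops one flip above
    it. *)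
Lemma local_confluence x b a d c :
  descent x b a -> contracted U x d c -> (b, a) != (d, c) ->
  exists y, [/\ reduces (flip x d c) y, reduces (flip x b a)
    (flip y b a), descent y b a,
    weak_le y (flip x d c) & contracted U x b a -> contracted U y b a].
Proof.
move=> dba cdc ne; have ddc := cdc.1.
have [eq_ad|ne_ad] := eqVneq a d.
  (* The two descents form a hexagon with top b a c. *)
  subst d; have [lt_ab lt_ca] := (descent_lt dba, descent_lt ddc).
  have lt_cb := ltn_trans lt_ca lt_ab.
  have d1 := descent_flip_nearl dba ddc; have d2 := descent_flip_nearl2 dba ddc.
  have d3 := descent_flip_nearr dba ddc; have d4 := descent_flip_nearr2 dba ddc.
  have c1 : contracted U (flip x b a) b c.
    split=> //; apply: spans_pattern_mono cdc.2 _ _ _ => //; first exact: ltnW.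
    move=> e /andP[lt_ce lt_ea]; have lt_eb := ltn_trans lt_ea lt_ab.
    by rewrite !inE before_flip_out ?(descent_beforel dba)
      ?neq_ltn ?lt_ce ?lt_ea ?lt_eb ?orbT.
  have c2 : contracted U (flip (flip x b a) b c) a c.
    split=> //; apply: spans_pattern_mono cdc.2 _ _ _ => //.
    move=> e /andP[lt_ce lt_ea]; have lt_eb := ltn_trans lt_ea lt_ab.
    by rewrite !inE !before_flip_out ?neq_ltn ?lt_ce ?lt_ea ?lt_eb ?orbT.
  have c3 : contracted U (flip x a c) b c.
    split=> //; apply: spans_pattern_mono cdc.2 _ _ _ => //; first exact: ltnW.
    move=> e /andP[lt_ce lt_ea]; have lt_eb := ltn_trans lt_ea lt_ab.
    by rewrite !inE before_flip_out ?(descent_beforel dba)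
      ?neq_ltn ?lt_ce ?lt_ea ?lt_eb ?orbT.
  exists (flip (flip x a c) b c); split=> //.
  - exact/(reduces_flip c3)/reduces_refl.
  - by apply/(reduces_flip c1)/(reduces_flip c2); rewrite flip_braid.
  - exact: flip_le.
  move=> [_ cba]; split=> //;
    apply: spans_pattern_mono cba _ _ _ => // e /andP[lt_ae lt_eb].
  by rewrite !inE !before_flip_out ?neq_ltn ?lt_ae ?lt_eb ?(ltn_trans lt_ca
    lt_ae) ?orbT.
have [eq_bc|ne_bc] := eqVneq b c.
  (* The two descents form a hexagon with top d b a. *)
  subst c; have [lt_ab lt_bd] := (descent_lt dba, descent_lt ddc).
  have lt_ad := ltn_trans lt_ab lt_bd.
  have d1 := descent_flip_nearl ddc dba; have d2 := descent_flip_nearl2 ddc dba.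
  have d3 := descent_flip_nearr ddc dba; have d4 := descent_flip_nearr2 ddc dba.
  have c1 : contracted U (flip x b a) d a.
    split=> //; apply: spans_pattern_mono cdc.2 _ _ _ => //; first exact: ltnW.
    move=> e /andP[lt_be lt_ed]; have lt_ae := ltn_trans lt_ab lt_be.
    by rewrite !inE before_flip_out ?neq_ltn ?lt_be ?lt_ed ?lt_ae ?orbT.
  have c2 : contracted U (flip (flip x b a) d a) d b.
    split=> //; apply: spans_pattern_mono cdc.2 _ _ _ => //.
    move=> e /andP[lt_be lt_ed]; have lt_ae := ltn_trans lt_ab lt_be.
    by rewrite !inE !before_flip_out ?neq_ltn ?lt_be ?lt_ed ?lt_ae ?orbT.
  have c3 : contracted U (flip x d b) d a.
    split=> //; apply: spans_pattern_mono cdc.2 _ _ _ => //; first exact: ltnW.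
    move=> e /andP[lt_be lt_ed]; have lt_ae := ltn_trans lt_ab lt_be.
    by rewrite !inE before_flip_out ?neq_ltn ?lt_be ?lt_ed ?lt_ae ?orbT.
  exists (flip (flip x d b) d a); split=> //.
  - exact/(reduces_flip c3)/reduces_refl.
  - by apply/(reduces_flip c1)/(reduces_flip c2); rewrite flip_braid.
  - exact: flip_le.
  move=> [_ cba]; split=> //;
    apply: spans_pattern_mono cba _ _ _ => // e /andP[lt_ae lt_eb].
  by rewrite !inE !before_flip_out ?neq_ltn ?lt_ae ?lt_eb ?(ltn_trans lt_eb
    lt_bd) ?orbT.
have ne_bd : b != d.
  apply: contraNneq ne => eq_bd; rewrite xpair_eqE eq_bd eqxx /=.
  by rewrite -(descent_eq dba ddc) eq_bd.
have dsw : descent (flip x d c) b a by apply: descent_flip_far => //;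
  rewrite eq_sym.
exists (flip x d c); split=> //.
- by rewrite -flip_comm //; apply/reduces_flip/reduces_refl;
  exact: contracted_flip_far.
- exact: weak_le_refl.
- by move=> cba; apply: contracted_flip_far => //; rewrite eq_sym.
Qed.

Lemma pi_down_rel_ex x : exists y, pi_down_rel U x y.
Proof.
have [k] := ubnP (ninv x); elim: k x => // k IH x lt_k.
have [avx|] := boolP (avoids U x); first by exists x; exact: pi_down_stop.
move=> /avoidsP navx; have [b [a cba]] : exists b a, contracted U x b a.
  by apply: contra_notP navx => no b a cba; apply: no; exists b, a.
have [|y rel_y] := IH (flip x b a); first by rewrite -ltnS -(ninv_flip cba.1).
by exists y; exact: (reduces_flip cba (@reduces_refl _)).
Qed.

Lemma pi_down_relP x y : pi_down_rel U x y ->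
  avoids U x /\ y = x \/
  exists b a, contracted U x b a /\ pi_down_rel U (flip x b a) y.
Proof.
case=> {x y} [x avx|x x' y /swap_instanceP[b [a [cba ->]]] rel_y];
  first by left.
by right; exists b, a.
Qed.

(** Newman's argument: two first steps are joined by [local_confluence], whose
    last clause makes the remaining flip a contracted one. *)
Lemma pi_down_rel_uniq x y y' : pi_down_rel U x y -> pi_down_rel U x y' ->
  y = y'.
Proof.
have [k] := ubnP (ninv x); elim: k x y y' => // k IH x y y' lt_k.
case/pi_down_relP => [[/avoidsP avx ->]|[b [a [cba rel_y]]]].
  by case/pi_down_relP => [[_ ->] //|[b [a [/avx]]]].
case/pi_down_relP => [[/avoidsP/(_ _ _ cba) //]|[d [c [cdc rel_y']]]].
have lt1 : ninv (flip x b a) < k by rewrite -ltnS -(ninv_flip cba.1).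
have lt2 : ninv (flip x d c) < k by rewrite -ltnS -(ninv_flip cdc.1).
have [[eq_b eq_a]|ne] := eqVneq (b, a) (d, c).
  by subst d c; exact: IH lt1 rel_y rel_y'.
have [w [red1 red2 dw _ /(_ cba) cw]] := local_confluence cba.1 cdc ne.
have [z rel_z] := pi_down_rel_ex (flip w b a).
rewrite (IH _ _ _ lt1 rel_y (red2 _ rel_z)).
apply: (IH _ _ _ lt2 _ rel_y').
exact/red1/(reduces_flip cw (@reduces_refl _)).
Qed.

Lemma pi_downP x : pi_down_rel U x (pi_down U x).
Proof. exact: (xgetPex x (pi_down_rel_ex x)). Qed.

Lemma pi_down_eq x y : pi_down_rel U x y -> pi_down U x = y.
Proof. exact: pi_down_rel_uniq (pi_downP x). Qed.

Lemma reduces_pi_down x y : reduces x y -> pi_down U x = pi_down U y.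
Proof. by move=> reduces_xy; exact/pi_down_eq/reduces_xy/pi_downP. Qed.

Lemma pi_down_flip x b a : contracted U x b a ->
  pi_down U (flip x b a) = pi_down U x.
Proof. by move=> cba; apply/esym/reduces_pi_down/(reduces_flip
  cba)/reduces_refl. Qed.

Lemma pi_down_id x : avoids U x -> pi_down U x = x.
Proof. by move=> avx; exact/pi_down_eq/pi_down_stop. Qed.

Lemma pi_down_le x : weak_le (pi_down U x) x.
Proof.
elim: (pi_downP x) => [y _|y y' z]; first exact: weak_le_refl.
move=> /swap_instanceP[b [a [cba ->]]] _ le_z.
exact: weak_le_trans le_z (flip_le cba.1).
Qed.

(** It suffices to treat a cover. Pushing down the larger element by a
    contracted descent, [local_confluence] produces a cover of smaller elements
    with the same projections. *)
Lemma pi_down_mono x y : weak_le x y -> weak_le (pi_down U x) (pi_down U y).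
Proof.
have [k] := ubnP (ninv y); elim: k x y => // k IH x y lt_k le_xy.
have [->|/(exists_cover le_xy)[b [a [dba le_x]]]] := eqVneq x y.
  exact: weak_le_refl.
have lt1 : ninv (flip y b a) < k by rewrite -ltnS -(ninv_flip dba).
apply: (weak_le_trans (IH _ _ lt1 le_x)).
have [[avy ->]|[d [c [cdc _]]]] := pi_down_relP (pi_downP y).
  exact: weak_le_trans (pi_down_le _) (flip_le dba).
have [[-> ->]|ne] := eqVneq (b, a) (d, c).
  by rewrite pi_down_flip //; exact: weak_le_refl.
have [w [red1 red2 dw le_w _]] := local_confluence dba cdc ne.
rewrite -(pi_down_flip cdc) (reduces_pi_down red1) (reduces_pi_down red2).
apply: IH; last exact: flip_le.
by rewrite -ltnS (leq_ltn_trans _ lt_k) // (ninv_flip cdc.1) ltnS weak_le_ninv.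
Qed.

(** [pi_down y] is the greatest avoider below [y]. *)
Lemma avoider_le_pi_down x y : avoids U x ->
  weak_le x (pi_down U y) = weak_le x y.
Proof.
move=> avx; apply/idP/idP => [le_xy|/pi_down_mono]; last by rewrite pi_down_id.
exact: weak_le_trans le_xy (pi_down_le y).
Qed.

End Projection.

(** * Reversal and the greatest element of a class *)

Section Duality.

Lemma dual_pattern_subproof (P : pattern) : pat_VC P \subset middle (pat_k P).
Proof. exact: subsetDl. Qed.

Definition dual_pattern (P : pattern) : pattern :=
  Pattern (pat_k_ge2 P) (dual_pattern_subproof P).

Definition dual_patterns (U : set pattern) : set pattern :=
  fun P => exists Q, U Q /\ P = dual_pattern Q.

Variable n : nat.
Implicit Types (U : set pattern) (x y z : 'S_n) (a b : 'I_n) (A : {set 'I_n}).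

Lemma spans_pattern_dual U a b A : spans_pattern U a b A ->
  spans_pattern (dual_patterns U) a b (~: A).
Proof.
move=> [P [UP [f [homo_f f_ab fV]]]]; exists (dual_pattern P).
split; first by exists P.
exists f; split=> // i mid_i; rewrite !inE -fV //; move: mid_i.
by rewrite inE => ->; rewrite andbT.
Qed.

Lemma dual_spans_pattern U a b A : spans_pattern (dual_patterns U) a b A ->
  spans_pattern U a b (~: A).
Proof.
move=> [_ [[P [UP ->]] [f [homo_f f_ab fV]]]]; exists P; split=> //.
exists f; split=> // i mid_i; rewrite inE -fV // !inE; move: mid_i.
by rewrite inE => ->; rewrite andbT negbK.
Qed.

(** The values on the left of a descent are, in the reversed word, those on its
    right; so the set in [spans_pattern] is complemented. *)
Lemma contracted_rev U U' x b a :
  (forall A, spans_pattern U a b A -> spans_pattern U' a b (~: A)) ->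
  contracted U x b a -> contracted U' (rev_perm (flip x b a)) b a.
Proof.
move=> dualUU' [dba cba]; split.
  rewrite /descent (descent_lt dba) !pos_rev !pos_flip tpermL tpermR /=.
  move: dba; rewrite /descent.
  by move: (ltn_ord ((x^-1)%g a)) (ltn_ord ((x^-1)%g b)); lia.
apply: spans_pattern_mono (dualUU' _ cba) _ _ _ => // e /andP[lt_ae lt_eb].
rewrite !inE before_rev -before_total ?(neq_ltn b) ?lt_eb ?orbT //.
have ne_eb : e != b by rewrite neq_ltn lt_eb.
have ne_ea : e != a by rewrite neq_ltn lt_ae orbT.
by rewrite !(before_total _ (_ : b != e)) 1?eq_sym // before_flip_out.
Qed.

Lemma flip_rev x b a : flip (rev_perm (flip x b a)) b a = rev_perm x.
Proof. by rewrite /rev_perm /flip -!mulgA tperm2 mulg1. Qed.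

Lemma pi_down_rev U U' x :
  (forall a b A, spans_pattern U a b A -> spans_pattern U' a b (~: A)) ->
  pi_down U' (rev_perm (pi_down U x)) = pi_down U' (rev_perm x).
Proof.
move=> dualUU'; elim: (pi_downP U x) => // y y' z.
move=> /swap_instanceP[b [a [cba ->]]] _ ->.
have := contracted_rev (@dualUU' a b) cba => /pi_down_flip <-.
by rewrite flip_rev.
Qed.

(** Projecting the reversed word with respect to the dual patterns and
    reversing again moves up inside the class, to a place that does not depend
    on the element chosen. *)
Lemma class_max U x :
  exists m, pi_down U m = pi_down U x /\
    forall y, pi_down U y = pi_down U x -> weak_le y m.
Proof.
exists (rev_perm (pi_down (dual_patterns U) (rev_perm x))); split=> [|y eq_y].
  by rewrite (pi_down_rev _ (@dual_spans_pattern U)) rev_permK.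
rewrite -weak_le_rev rev_permK -(pi_down_rev x (@spans_pattern_dual U)) -eq_y.
rewrite (pi_down_rev y (@spans_pattern_dual U)); exact: pi_down_le.
Qed.

End Duality.

(** * Restriction to a set of values *)

Section Parts.
Variable n : nat.
Implicit Types (x y : 'S_n) (S T : {set 'I_n}) (a b : 'I_n).

Definition letters S : seq nat := [seq val a | a <- enum S].

Lemma sorted_enum_ord : sorted (relpre val ltn) (enum 'I_n).
Proof. by rewrite -sorted_map val_enum_ord iota_ltn_sorted. Qed.

Lemma sorted_letters S : sorted ltn (letters S).
Proof.
rewrite sorted_map /enum_mem -enumT; apply: sorted_filter.
  by move=> ? ? ?; exact: ltn_trans.
exact: sorted_enum_ord.
Qed.

Lemma uniq_letters S : uniq (letters S).
Proof. by have := sorted_letters S; rewrite ltn_sorted_uniq_leq => /andP[]. Qed.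

Lemma size_letters S : size (letters S) = #|S|.
Proof. by rewrite size_map -cardE. Qed.

Lemma mem_letters S a : (val a \in letters S) = (a \in S).
Proof. by rewrite mem_map ?mem_enum //; exact: val_inj. Qed.

Lemma sort_lettersE S s : perm_eq s (letters S) -> sort leq s = letters S.
Proof.
move=> /permPl eq_s; apply: (sorted_eq leq_trans anti_leq).
- by apply: sort_sorted; exact: leq_total.
- by have := sorted_letters S; rewrite ltn_sorted_uniq_leq => /andP[].
- by apply/permPl => P; rewrite perm_sort eq_s.
Qed.

Lemma word_codom x : word x = [seq val a | a <- codom x].
Proof. by rewrite codomE -map_comp. Qed.

Lemma size_word x : size (word x) = n.
Proof. by rewrite size_map size_enum_ord. Qed.

Lemma restrE x S : restr x S = [seq k <- word x | k \in letters S].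
Proof.
rewrite /restr word_codom [RHS]filter_map; congr map.
by apply: eq_filter => a /=; rewrite mem_letters.
Qed.

Lemma restr_perm x S : perm_eq (restr x S) (letters S).
Proof.
apply: perm_map; apply: uniq_perm;
  rewrite ?enum_uniq ?filter_uniq ?uniq_codom //.
move=> a; rewrite mem_filter mem_enum -[a in a \in codom x](permKV x) codom_f.
by rewrite andbT.
Qed.

Lemma uniq_restr x S : uniq (restr x S).
Proof. by rewrite (perm_uniq (restr_perm x S)) uniq_letters. Qed.

Lemma size_restr x S : size (restr x S) = #|S|.
Proof. by rewrite (perm_size (restr_perm x S)) size_letters. Qed.

Section Block.
Variables (S : {set 'I_n}) (m : nat).
Hypothesis card_S : #|S| = m.

Lemma letter_subproof (k : 'I_m) : nth 0 (letters S) k < n.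
Proof.
have : nth 0 (letters S) k \in letters S by rewrite mem_nth // size_letters
  card_S.
by case/mapP => a _ ->; exact: ltn_ord.
Qed.

Definition letter k : 'I_n := Ordinal (letter_subproof k).

Lemma letter_lt k l : (letter k < letter l) = (k < l).
Proof. by rewrite /= sorted_nth_lt ?sorted_letters // size_letters card_S. Qed.

Lemma letterP a : reflect (exists k, a = letter k) (a \in S).
Proof.
apply: (iffP idP) => [|[k ->]]; last first.
  by rewrite -mem_letters /= mem_nth // size_letters card_S.
rewrite -mem_letters => a_in; have := a_in;
  rewrite -index_mem size_letters card_S => lt_m.
by exists (Ordinal lt_m); apply: val_inj; rewrite /= nth_index.
Qed.

Definition part x : 'S_m := st m (restr x S).

(** Filtering the word of [x] keeps its letters in the order of their
    positions, and the letter in place [i] of the result is the one of rank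
    [part x i] in [S]. *)
Lemma part_lt x (i j : 'I_m) :
  i < j -> before x (letter (part x i)) (letter (part x j)).
Proof.
have letter_part (k : 'I_m) : val (letter (part x k)) = nth 0 (restr x S) k.
  rewrite /= -(sort_lettersE (restr_perm x S)) nth_st ?uniq_restr //.
  by rewrite size_restr.
move=> lt_ij.
have sorted_x : sorted (before x) (codom x).
  rewrite codomE sorted_map (@eq_sorted _ _ (relpre val ltn)).
    exact: sorted_enum_ord.
  by move=> k l; rewrite /= /before !permK.
have before_tr : transitive (before x) by move=> c d e; exact: before_trans.
have := sorted_filter before_tr (mem S) sorted_x;
  set r := filter _ _ => sorted_r.
have sz_r : size r = m by rewrite -card_S -(size_restr x) size_map.
have := sorted_ltn_nth before_tr (letter i) sorted_r.
move=> /(_ i j); rewrite !inE sz_r => /(_ (ltn_ord i) (ltn_ord j) lt_ij).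
suff nth_r (k : 'I_m) : nth (letter i) r k = letter (part x k)
  by rewrite !nth_r.
by apply: val_inj; rewrite letter_part (nth_map (letter i)) // sz_r.
Qed.

Lemma before_part x k l : before (part x) k l = before x (letter k) (letter l).
Proof.
have lt_before (k' l' : 'I_m) : before (part x) k' l' ->
  before x (letter k') (letter l').
  by move=> /(part_lt x); rewrite !permKV.
apply/idP/idP => [/lt_before //|]; have [->|ne_kl] := eqVneq k l;
  first by rewrite before_irr.
rewrite (before_total _ ne_kl); apply: contraTN => /lt_before.
by rewrite (before_total x (_ : letter k != letter l))
  ?negbK // -val_eqE /= nth_uniq ?uniq_letters // size_letters card_S.
Qed.

Lemma uniq_relabel (u : 'S_m) : uniq (relabel (letters S) u).
Proof.
rewrite map_inj_in_uniq ?enum_uniq // => i j _ _ /eqP.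
rewrite nth_uniq ?uniq_letters ?size_letters ?card_S //.
by move=> /eqP/val_inj/perm_inj.
Qed.

Lemma st_relabel (u : 'S_m) : st m (relabel (letters S) u) = u.
Proof.
apply: perm_order_inj => i j;
  rewrite st_lt ?uniq_relabel ?size_relabel // !nth_relabel.
by rewrite sorted_nth_lt ?sorted_letters ?size_letters ?card_S.
Qed.

Lemma mem_relabel (u : 'S_m) k : (k \in relabel (letters S) u)
  = (k \in letters S).
Proof.
apply/mapP/idP => [[i _ ->]|k_in];
  first by rewrite mem_nth ?size_letters ?card_S.
have := k_in; rewrite -index_mem size_letters card_S => lt_m.
exists ((u^-1)%g (Ordinal lt_m)); first by rewrite mem_enum.
by rewrite permKV nth_index.
Qed.

End Block.

(** * Permutations with a given prefix set *)

Section Prefix.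
Variable T : {set 'I_n}.

Definition split_at x : bool := prefix_set x #|T| == T.

Lemma mem_prefix_set x k a : (a \in prefix_set x k) = ((x^-1)%g a < k).
Proof.
apply/imsetP/idP => [[i + ->]|lt_a]; first by rewrite inE permK.
by exists ((x^-1)%g a); rewrite ?inE ?permKV.
Qed.

Lemma prefix_setE x k : prefix_set x k = [set a | (x^-1)%g a < k].
Proof. by apply/setP => a; rewrite mem_prefix_set inE. Qed.

Lemma split_atP x : reflect (forall a, (a \in T) = ((x^-1)%g a < #|T|))
  (split_at x).
Proof.
apply: (iffP eqP) => [eq_T a|eq_T]; last by apply/setP => a;
  rewrite mem_prefix_set eq_T.
by rewrite -{1}eq_T mem_prefix_set.
Qed.

(** If every letter of [T] precedes every other letter, a letter of [T] has
    fewer than [#|T|] letters before it; the prefix set and [T] then agree by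
    cardinality. *)
Lemma split_at_before x : reflect (forall a b, a \in T -> b \notin T ->
  before x a b) (split_at x).
Proof.
apply: (iffP (split_atP x)) => [inT a b|cross].
  by rewrite !inT -leqNgt; exact: leq_trans.
suff eq_T : T = prefix_set x #|T| by move=> a; rewrite {1}eq_T mem_prefix_set.
have le_Tn : #|T| <= n by rewrite -[n in _ <= n]card_ord max_card.
apply/eqP; rewrite eqEcard prefix_setE card_pos_lt // leqnn andbT.
apply/subsetP => a aT; rewrite inE pos_count; apply: proper_card.
apply/properP; split; last by exists a => //; rewrite inE before_irr.
apply/subsetP => c; rewrite inE; apply: contraLR => /(cross _ _ aT).
by rewrite /before -leqNgt => /ltnW.
Qed.

Lemma card_compl : #|~: T| = n - #|T|.
Proof. by rewrite cardsCs finset.setCK card_ord. Qed.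

Definition lpart : 'S_n -> 'S_#|T| := @part T #|T|.
Definition rpart : 'S_n -> 'S_(n - #|T|) := @part (~: T) (n - #|T|).

(** For two permutations with prefix set [T], a pair with one value in [T] and
    one outside is ordered in the same way, so only the pairs inside one factor
    are to be compared. *)
Lemma weak_le_split x y : split_at x -> split_at y ->
  weak_le x y = weak_le (lpart x) (lpart y) && weak_le (rpart x) (rpart y).
Proof.
move=> /split_at_before Tx /split_at_before Ty; apply/weak_leP/andP => [le_xy|].
  split; apply/weak_leP => k l lt_kl.
    by rewrite !(before_part (erefl #|T|)); apply: le_xy; rewrite letter_lt.
  by rewrite !(before_part card_compl); apply: le_xy; rewrite letter_lt.
move=> [/weak_leP le_l /weak_leP le_r] a b lt_ab.
have [aT|naT] := boolP (a \in T); have [bT|nbT] := boolP (b \in T).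
- have [k eq_a] := letterP (erefl #|T|) a aT;
  have [l eq_b] := letterP (erefl #|T|) b bT.
  by rewrite eq_a eq_b -!before_part; apply: le_l;
    rewrite -(letter_lt (erefl #|T|)) -eq_a -eq_b.
- have ne : b != a by rewrite neq_ltn lt_ab orbT.
  by rewrite (before_total x ne) Tx.
- by rewrite Ty.
- have aC : a \in ~: T by rewrite inE.
  have bC : b \in ~: T by rewrite inE.
  have [k eq_a] := letterP card_compl a aC;
    have [l eq_b] := letterP card_compl b bC.
  by rewrite eq_a eq_b -!before_part; apply: le_r;
    rewrite -(letter_lt card_compl) -eq_a -eq_b.
Qed.

Lemma split_inj x y : split_at x -> split_at y ->
  lpart x = lpart y -> rpart x = rpart y -> x = y.
Proof.
move=> Tx Ty eq_l eq_r; apply: weak_le_anti;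
  rewrite weak_le_split // eq_l eq_r !weak_le_refl //.
Qed.

(** The inverse of the pair of [lpart] and [rpart]. *)
Definition glue (u : 'S_#|T|) (v : 'S_(n - #|T|)) : 'S_n :=
  st n (relabel (letters T) u ++ relabel (letters (~: T)) v).

(** The two relabelled words together consist of the letters [0, ..., n - 1],
    for which standardization changes nothing. *)
Lemma word_glue u v :
  word (glue u v) = relabel (letters T) u ++ relabel (letters (~: T)) v.
Proof.
set w := _ ++ _.
have Uw : uniq w.
  rewrite cat_uniq !uniq_relabel ?card_compl // andbT; apply/hasPn => k.
  rewrite !mem_relabel ?card_compl // => /mapP[a].
  by rewrite mem_enum inE => naT ->; rewrite mem_letters.
have szw : size w = n.
  rewrite size_cat !size_relabel subnKC //.
  by rewrite -[n in _ <= n]card_ord max_card.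
have sort_w : sort leq w = iota 0 n.
  rewrite -val_enum_ord.
  have -> : [seq val i | i <- enum 'I_n] = letters setT.
    by congr map; apply: eq_enum => a; rewrite !inE.
  apply: sort_lettersE; apply: uniq_perm => //; first exact: uniq_letters.
  move=> k; rewrite mem_cat !mem_relabel ?card_compl //.
  apply/orP/mapP => [[]/mapP[a _ ->]|[a _ ->]]; first by exists a;
    rewrite ?mem_enum ?inE.
    by exists a; rewrite ?mem_enum ?inE.
  by rewrite !mem_letters inE; apply/orP; exact: orbN.
apply: (@eq_from_nth _ 0) => [|k]; rewrite size_word ?szw // => lt_k.
rewrite (nth_map (Ordinal lt_k)) ?size_enum_ord //.
rewrite (_ : nth _ _ _ = Ordinal lt_k); last by apply: val_inj;
  rewrite /= nth_enum_ord.
by rewrite -[RHS](nth_st (Ordinal lt_k) Uw szw) sort_w nth_iota.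
Qed.

Lemma split_glue u v : split_at (glue u v).
Proof.
apply/split_atP => a; rewrite -mem_take_codom -(mem_map val_inj)
  map_take -word_codom.
by rewrite word_glue take_size_cat ?size_relabel // mem_relabel // mem_letters.
Qed.

Lemma lpart_glue u v : lpart (glue u v) = u.
Proof.
rewrite /lpart /part restrE word_glue filter_cat.
have /all_filterP-> : all [in letters T] (relabel (letters T) u).
  by apply/allP => k; rewrite mem_relabel.
rewrite (_ : filter _ _ = [::]) ?cats0 ?st_relabel //.
apply/eqP; rewrite -size_eq0 size_filter -leqn0 leqNgt -has_count;
  apply/hasPn => k.
rewrite mem_relabel ?card_compl // => /mapP[a]; rewrite mem_enum inE => naT ->.
by rewrite mem_letters.
Qed.

Lemma rpart_glue u v : rpart (glue u v) = v.
Proof.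
rewrite /rpart /part restrE word_glue filter_cat.
rewrite (_ : filter _ _ = [::]).
  have /all_filterP-> : all [in letters (~: T)] (relabel (letters (~: T)) v).
    by apply/allP => k; rewrite mem_relabel ?card_compl.
  by rewrite st_relabel ?card_compl.
apply/eqP; rewrite -size_eq0 size_filter -leqn0 leqNgt -has_count;
  apply/hasPn => k.
by rewrite mem_relabel // => /mapP[a]; rewrite mem_enum => aT ->;
  rewrite mem_letters inE aT.
Qed.

Lemma glue_parts x : split_at x -> glue (lpart x) (rpart x) = x.
Proof.
by move=> Tx; apply: split_inj; rewrite ?split_glue // ?lpart_glue ?rpart_glue.
Qed.

Lemma filter_codom_split x : split_at x ->
  [seq a <- codom x | a \in T] = take #|T| (codom x) /\
  [seq a <- codom x | a \in ~: T] = drop #|T| (codom x).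
Proof.
move=> /split_atP Tx; rewrite -{1 3}(cat_take_drop #|T| (codom x)) !filter_cat.
have nil_filter (P : pred 'I_n) s : {in s, forall a, ~~ P a} ->
  filter P s = [::].
  by move=> nP; apply/eqP; rewrite -size_eq0 size_filter -leqn0 leqNgt
    -has_count; apply/hasPn.
split.
  rewrite [X in _ ++ X]nil_filter ?cats0.
    by apply/all_filterP/allP => a; rewrite mem_take_codom Tx.
  by move=> a; rewrite mem_drop_codom Tx -leqNgt.
rewrite nil_filter ?cat0s.
  by apply/all_filterP/allP => a; rewrite mem_drop_codom inE Tx -leqNgt.
by move=> a; rewrite mem_take_codom inE Tx negbK.
Qed.

Lemma st_take_split x : split_at x -> st #|T| (take #|T| (word x)) = lpart x.
Proof.
move=> /filter_codom_split[eq_take _].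
by rewrite /lpart /part /restr eq_take word_codom map_take.
Qed.

Lemma st_drop_split x : split_at x ->
  st (n - #|T|) (drop #|T| (word x)) = rpart x.
Proof.
move=> /filter_codom_split[_ eq_drop].
by rewrite /rpart /part /restr eq_drop word_codom map_drop.
Qed.

(** The bounds are the words increasing, respectively decreasing, on both
    factors. *)
Lemma split_interval : exists e w, forall x,
  split_at x = weak_le e x && weak_le x w.
Proof.
exists (glue 1%g 1%g), (glue (rev_perm 1%g) (rev_perm 1%g)) => x.
apply/idP/andP => [Tx|[/weak_leP le_e /weak_leP le_w]].
  by rewrite !weak_le_split ?split_glue // !lpart_glue !rpart_glue !weak_le_1
    !weak_le_rev1.
apply/split_at_before => a b aT nbT.
have [lt_ab|lt_ba|/val_inj eq_ab] := ltngtP a b.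
- have ne_ab : a != b by rewrite neq_ltn lt_ab.
  rewrite (before_total _ ne_ab); apply/negP => /(le_w _ _ lt_ab); apply/negP.
  by rewrite -before_total //; apply: (split_at_before _ (split_glue _ _)).
- by apply: le_e => //; apply: (split_at_before _ (split_glue _ _)).
- by rewrite -eq_ab aT in nbT.
Qed.

End Prefix.
End Parts.

(** * The part of a class with a given prefix set *)

Section SplitClass.
Variables (U : set pattern) (n : nat) (z : 'S_n) (T : {set 'I_n}).
Hypotheses (avz : avoids U z) (goodT : good U z T).

Lemma mem_split_class x :
  (x \in split_class U z T) = (pi_down U x == z) && split_at T x.
Proof. by rewrite inE /equivalent (pi_down_id avz). Qed.

Lemma split_class_neq0 : exists x, x \in split_class U z T.
Proof.
have /existsP[x /andP[eq_z eq_T]] := goodT; exists x.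
by rewrite mem_split_class eq_z /split_at eq_sym.
Qed.

(** The meet lies above [z], which is below both arguments; hence it projects
    to an element between [z] and [z]. *)
Lemma split_class_meet x y : x \in split_class U z T ->
  y \in split_class U z T ->
  exists m, [/\ m \in split_class U z T, weak_le m x & weak_le m y].
Proof.
rewrite !mem_split_class; have [e [w Tew]] := split_interval T; rewrite !Tew.
move=> /and3P[/eqP zx ex xw] /and3P[/eqP zy ey yw].
have [m [mx my mP]] := weak_le_meet x y; exists m; split=> //.
rewrite mem_split_class Tew mP // (weak_le_trans mx xw) !andbT.
apply/eqP/weak_le_anti; first by rewrite -[X in weak_le _ X]zx pi_down_mono.
rewrite -[X in weak_le X _](pi_down_id avz); apply: pi_down_mono; apply: mP.
  by rewrite -zx pi_down_le.
by rewrite -zy pi_down_le.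
Qed.

(** The join lies below the greatest element of the class of [z]. *)
Lemma split_class_join x y : x \in split_class U z T ->
  y \in split_class U z T ->
  exists m, [/\ m \in split_class U z T, weak_le x m & weak_le y m].
Proof.
rewrite !mem_split_class; have [e [w Tew]] := split_interval T; rewrite !Tew.
move=> /and3P[/eqP zx ex xw] /and3P[/eqP zy ey yw].
have [m [mx my mP]] := weak_le_join x y; exists m; split=> //.
rewrite mem_split_class Tew mP // (weak_le_trans ex mx) !andbT.
have [M [zM Mmax]] := class_max U x.
apply/eqP/weak_le_anti; last by rewrite -[X in weak_le X _]zx pi_down_mono.
rewrite -zx -zM; apply/pi_down_mono/mP; apply: Mmax => //.
by rewrite zx.
Qed.

(** An element of the split class with the fewest inversions lies below all
    others, because the meet with any of them is again in the class; so being
    minimal and being least agree. *)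
Lemma zmin_spec : zmin U z T \in split_class U z T /\
  forall y, y \in split_class U z T -> weak_le (zmin U z T) y.
Proof.
have [x0 x0S] := split_class_neq0.
have [m mS mP] := arg_minnP (@ninv n) x0S.
have m_le y : y \in split_class U z T -> weak_le m y.
  move=> yS; have [w [wS wm wy]] := split_class_meet mS yS.
  have [eq_wm|ne_wm] := eqVneq w m; first by rewrite -eq_wm.
  by have := weak_le_lt wm ne_wm; rewrite ltnNge mP.
suff -> : zmin U z T = m by [].
rewrite /zmin; apply: xget_unique => [|y [yS ymin]].
  by split=> // y yS ym; apply: weak_le_anti => //; exact: m_le.
by apply/esym/ymin => //; exact: m_le.
Qed.

Lemma zmax_spec : zmax U z T \in split_class U z T /\
  forall y, y \in split_class U z T -> weak_le y (zmax U z T).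
Proof.
have [x0 x0S] := split_class_neq0.
have [m mS mP] := arg_maxnP (@ninv n) x0S.
have m_ge y : y \in split_class U z T -> weak_le y m.
  move=> yS; have [w [wS mw yw]] := split_class_join mS yS.
  have [eq_mw|ne_mw] := eqVneq m w; first by rewrite eq_mw.
  by have := weak_le_lt mw ne_mw; rewrite ltnNge; have := mP _ wS => /= ->.
suff -> : zmax U z T = m by [].
rewrite /zmax; apply: xget_unique => [|y [yS ymax]].
  by split=> // y yS my; apply: weak_le_anti => //; exact: m_ge.
by apply/esym/ymax => //; exact: m_ge.
Qed.

(** Convexity of the class, from the monotonicity of [pi_down]. *)
Lemma split_class_interval x : split_at T x ->
  (x \in split_class U z T) = weak_le (zmin U z T) x && weak_le x (zmax U z T).
Proof.
move=> Tx; have [minS min_le] := zmin_spec; have [maxS max_ge] := zmax_spec.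
apply/idP/andP => [xS|[le1 le2]]; first by split; [exact: min_le|exact: max_ge].
rewrite mem_split_class Tx andbT; apply/eqP/weak_le_anti.
  move: maxS; rewrite mem_split_class => /andP[/eqP <- _].
  exact: pi_down_mono.
move: minS; rewrite mem_split_class => /andP[/eqP eq_z _].
by rewrite -{1}eq_z; exact: pi_down_mono.
Qed.

End SplitClass.

Local Open Scope ring_scope.

(** * Linearity of formal sums and tensors *)

Section FormalSums.
Variable K : fieldType.

Lemma fglift_sum (A : choiceType) (M : lmodType K) (f : A -> M)
    (I : Type) (r : seq I) (P : pred I) (F : I -> {freeg A / K}) :
  fglift f (\sum_(i <- r | P i) F i) = \sum_(i <- r | P i) fglift f (F i).
Proof.
have lift0 : fglift f 0 = 0.
  by rewrite -[X in fglift f X](subrr 0) lift_is_additive subrr.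
apply: (big_morph _ _ lift0) => u v;
  rewrite -{1}[v]opprK -[- v]sub0r !lift_is_additive.
by rewrite lift0 sub0r opprK.
Qed.

Lemma fglift_basis (A : choiceType) (M : lmodType K) (f : A -> M) (a : A) :
  fglift f << a >> = f a.
Proof. by rewrite liftU scale1r. Qed.

Lemma fgliftE (A : choiceType) (M : lmodType K) (f : A ->
  M) (u : {freeg A / K}) :
  fglift f u = \sum_(a <- freeg.dom u) freeg.coeff a u *: f a.
Proof.
rewrite -{1}(freeg_sumE u) fglift_sum; apply: eq_bigr => a _; exact: liftU.
Qed.

Variables A B : choiceType.

Lemma tensor_suml (I : Type) (r : seq I) (P : pred I) (F : I -> {freeg A / K})
    (v : {freeg B / K}) :
  tensor (\sum_(i <- r | P i) F i) v = \sum_(i <- r | P i) tensor (F i) v.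
Proof. exact: fglift_sum. Qed.

Lemma tensor_sumr (I : Type) (r : seq I) (P : pred I) (u : {freeg A / K})
    (F : I -> {freeg B / K}) :
  tensor u (\sum_(i <- r | P i) F i) = \sum_(i <- r | P i) tensor u (F i).
Proof.
rewrite /tensor fgliftE.
under eq_bigr => a _ do rewrite fglift_sum scaler_sumr.
by rewrite exchange_big; apply: eq_bigr => i _; rewrite fgliftE.
Qed.

Lemma tensor_basis (a : A) (b : B) :
  tensor (<< a >> : {freeg A / K}) (<< b >> : {freeg B / K}) = << (a, b) >>.
Proof. by rewrite /tensor !fglift_basis. Qed.

End FormalSums.

(** * Expansion of the coproduct *)

Section Coproduct.
Variables (K : fieldType) (U : set pattern).

Lemma rho_basis n (x : 'S_n) :
  rho U (bS K x) = if insub x is Some z then bAv K (z : Av U n) else 0.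
Proof. exact: fglift_basis. Qed.

Lemma rho_sum n (P : pred 'S_n) :
  \sum_(x | P x) rho U (bS K x) = \sum_(z : Av U n | P (val z)) bAv K z.
Proof.
rewrite (bigID (@avoids U n)) /= [X in _ + X]big1 ?addr0; last first.
  by move=> x /andP[_ nav]; rewrite rho_basis insubN.
rewrite (reindex_omap val (insub : 'S_n -> option (Av U n))) /=; last first.
  by move=> x /andP[_ av]; rewrite insubT.
apply: eq_big => z; last by rewrite rho_basis valK.
by rewrite valK eqxx (valP z) !andbT.
Qed.

Lemma DeltaAv_expand n (z : Av U n) :
  DeltaAv (bAv K z) = \sum_(y : 'S_n | pi_down U y == val z) \sum_(i < n.+1)
    tensor (rho U (bS K (st i (take i (word y)))))
           (rho U (bS K (st (n - i) (drop i (word y))))).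
Proof.
rewrite /DeltaAv /class_sum /bAv fglift_basis /Delta /tensor_map !fglift_sum.
apply: eq_bigr => y _; rewrite fglift_basis fglift_sum; apply: eq_bigr => i _.
by rewrite tensor_basis fglift_basis.
Qed.

(** Cutting the word of [y] after [i] letters amounts to choosing the set of
    its first [i] letters. *)
Lemma sum_prefix_sets n (y : 'S_n) (V : zmodType) (F : nat -> V) :
  \sum_(i < n.+1) F i = \sum_(T : {set 'I_n} | split_at T y) F #|T|.
Proof.
have card_prefix (i : 'I_n.+1) : #|prefix_set y i| = i.
  by rewrite prefix_setE card_pos_lt // -ltnS.
rewrite (reindex_onto (fun i : 'I_n.+1 => prefix_set y i)
  (fun T => inord #|T|)).
  apply: eq_big => [i|i _]; last by rewrite card_prefix.
  by rewrite /split_at card_prefix eqxx inord_val eqxx.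
move=> T /eqP splitT; rewrite inordK // ltnS.
by rewrite -[X in (_ <= X)%N](card_ord n) max_card.
Qed.

(** The split class is a product of two intervals, so the sum over it factors;
    [rho] keeps the avoiders, and for these the bound by [lpart zmax] or [rpart
    zmax] is the bound by its projection. *)
Lemma split_class_sum n (z : 'S_n) (T : {set 'I_n}) : avoids U z ->
  good U z T ->
  \sum_(y in split_class U z T)
    tensor (rho U (bS K (st #|T| (take #|T| (word y)))))
           (rho U (bS K (st (n - #|T|) (drop #|T| (word y))))) =
  tensor (I_sum K U z T) (J_sum K U z T).
Proof.
move=> avz goodT; have mem_S := mem_split_class T avz.
have [minS _] := zmin_spec avz goodT; have [maxS _] := zmax_spec avz goodT.
have /andP[_ min_T] : (pi_down U (zmin U z T) == z) && split_at T (zmin U z T).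
  by rewrite -mem_S.
have /andP[_ max_T] : (pi_down U (zmax U z T) == z) && split_at T (zmax U z T).
  by rewrite -mem_S.
transitivity (\sum_(y in split_class U z T)
    tensor (rho U (bS K (lpart T y))) (rho U (bS K (rpart T y)))).
  apply: eq_bigr => y; rewrite mem_S => /andP[_ Ty].
  by rewrite st_take_split // st_drop_split.
rewrite (reindex_onto (fun uv : 'S_#|T| * 'S_(n - #|T|) => glue uv.1 uv.2)
  (fun y => (lpart T y, rpart T y))) /=; last first.
  by move=> y; rewrite mem_S => /andP[_ Ty]; exact: glue_parts.
pose PI u := weak_le (lpart T (zmin U z T))
  u && weak_le u (lpart T (zmax U z T)).
pose PJ v := weak_le (rpart T (zmin U z T))
  v && weak_le v (rpart T (zmax U z T)).
transitivity (\sum_(uv : 'S_#|T| * 'S_(n - #|T|) | PI uv.1 && PJ uv.2)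
    tensor (rho U (bS K uv.1)) (rho U (bS K uv.2))).
  apply: eq_big => [[u v]|[u v] _] /=; last by rewrite lpart_glue rpart_glue.
  rewrite lpart_glue rpart_glue eqxx andbT.
  rewrite (split_class_interval avz goodT) ?split_glue //.
  rewrite !(weak_le_split (T := T)) ?split_glue // lpart_glue rpart_glue.
  by rewrite /PI /PJ andbACA.
rewrite -(pair_big PI PJ (fun u v => tensor (rho U (bS K u)) (rho U (bS K v))))
  /=.
under eq_bigr => u _ do rewrite -tensor_sumr.
rewrite -tensor_suml !rho_sum; congr tensor.
  by apply: eq_bigl => y; rewrite avoider_le_pi_down // (valP y).
by apply: eq_bigl => y; rewrite avoider_le_pi_down // (valP y).
Qed.

End Coproduct.

Theorem theorem1p3 (K : fieldType) (U : set pattern) (n : nat) (z : Av U n) :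
  DeltaAv (bAv K z) =
  \sum_(T : {set 'I_n} | good U (val z) T)
     tensor (I_sum K U (val z) T) (J_sum K U (val z) T).
Proof.
have avz := valP z.
rewrite DeltaAv_expand; under eq_bigr => y _ do
  rewrite (sum_prefix_sets y (fun i => tensor (rho U (bS K (st i (take i (word
    y)))))
    (rho U (bS K (st (n - i) (drop i (word y))))))).
rewrite (exchange_big_dep (good U (val z))) /=; last first.
  move=> y T eq_z /eqP splitT; apply/existsP; exists y.
  by rewrite eq_z splitT eqxx.
apply: eq_bigr => T goodT; rewrite -split_class_sum //.
by apply: eq_bigl => y; rewrite mem_split_class.
Qed.
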